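(* Let $N$ be a positive integer and $\omega\in\mathbb C$ a primitive $N$-th root of unity. Let $q\in\mathbb C^\times$ be such that either $|q|\neq1$, or $q$ is a primitive $(2m+1)$-th root of unity for some integer $m\ge1$. Let $z,w\in\mathbb C^\times$ be such that $|u|<1$ for all $$u\in\{z,\ w,\ zw,\ zq^2,\ wq^2,\ zwq^{2},\ zq^{-2},\ wq^{-2},\ zwq^{-2}\}.$$ Then the matrix $\mathcal R(\cdot)\in \mathrm M_{2N}(\mathbb C)\otimes\mathrm M_{2N}(\mathbb C)$ satisfies the Yang–Baxter equation $$\mathcal R(z)_{12}\,\mathcal R(zw)_{13}\,\mathcal R(w)_{23}=\mathcal R(w)_{23}\,\mathcal R(zw)_{13}\,\mathcal R(z)_{12}.$$
   Context: Identify $\mathrm M_{2N}(\mathbb C)=\mathrm M_2(\mathbb C)\otimes\mathrm M_N(\mathbb C)$. Let $e_{ij}$ be the matrix units of $\mathrm M_2(\mathbb C)$ and $\epsilon_{st}$ those of $\mathrm M_N(\mathbb C)$, and let $1$ be the identity matrix of the relevant size. Put $C=\sum_{t=1}^{N-1}\epsilon_{t,t+1}+\epsilon_{N,1}$, $D=\sum_{s=1}^N\omega^{s-1}\epsilon_{ss}$, $P=\sum_{s,t=1}^N\omega^{(s-1)(t-1)}\epsilon_{st}$ (so $P^{-1}CP=D$), and $\acute P=1\otimes P\in\mathrm M_2(\mathbb C)\otimes\mathrm M_N(\mathbb C)$. For $|x|<1$ let $$\mathcal A(x)=\exp\Big(-\sum_{k=1}^\infty\frac{x^k(q^k-q^{-k})}{k(q^k+q^{-k})}\Big).$$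 For $z\in\mathbb C^\times$ with $|z|,|zq^2|,|zq^{-2}|<1$ define elements of $\mathrm M_{2N}(\mathbb C)\otimes\mathrm M_{2N}(\mathbb C)$: $$\mathcal R_{1}(z)=1\otimes1-\frac{(q^2-1)q^{-1}}{1-z^N}\sum_{n=0}^{N-1}(z\omega)^n\,(e_{12}\otimes DC^n)\otimes(e_{21}\otimes C^{-n}),$$ $$\mathcal R_{0}(z)=1\otimes1-\frac{z(q^2-1)q^{-1}}{1-z^N}\sum_{n=0}^{N-1}z^n\,(e_{21}\otimes D^{-1}C^{n+1})\otimes(e_{12}\otimes C^{-(n+1)}),$$ $$\mathcal R_{\delta}(z)=(\acute P\otimes\acute P)\Big(\sum_{s,t=1}^N\Big\{\mathcal A(z\omega^{s-t+1})\,(e_{11}\otimes\epsilon_{ss})\otimes(e_{11}\otimes\epsilon_{tt})+\frac1{\mathcal A(zq^{-2}\omega^{s-t})}(e_{11}\otimes\epsilon_{ss})\otimes(e_{22}\otimes\epsilon_{tt})$$ $$\qquad+\frac1{\mathcal A(zq^{2}\omega^{s-t+1})}(e_{22}\otimes\epsilon_{ss})\otimes(e_{11}\otimes\epsilon_{tt})+\mathcal A(z\omega^{s-t})(e_{22}\otimes\epsilon_{ss})\otimes(e_{22}\otimes\epsilon_{tt})\Big\}\Big)(\acute P^{-1}\otimes\acute P^{-1}),$$ $$\mathcal R_{\mathfrak h}=\sum_{s,t=1}^N\Big\{q^{-1/2}\omega^{t-s}(e_{11}\otimes\epsilon_{ss})\otimes(e_{11}\otimes\epsilon_{tt})+q^{1/2}\omega^{t-1}(e_{11}\otimes\epsilon_{ss})\otimes(e_{22}\otimes\epsilon_{tt})$$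 $$\qquad+q^{1/2}\omega^{1-s}(e_{22}\otimes\epsilon_{ss})\otimes(e_{11}\otimes\epsilon_{tt})+q^{-1/2}(e_{22}\otimes\epsilon_{ss})\otimes(e_{22}\otimes\epsilon_{tt})\Big\},$$ where $q^{1/2}$ is a fixed square root of $q$. Finally $$\mathcal R(z)=\mathcal R_{1}(z)\,\mathcal R_{\delta}(z)\,\mathcal R_{0}(z)\,\mathcal R_{\mathfrak h}.$$ For $M=\sum_tm_t\otimes m'_t$ acting on $V\otimes V$ ($V=\mathbb C^{2N}$), $M_{12}=\sum m_t\otimes m_t'\otimes\mathrm{id}$, $M_{13}=\sum m_t\otimes\mathrm{id}\otimes m'_t$, $M_{23}=\sum\mathrm{id}\otimes m_t\otimes m'_t$ act on $V^{\otimes3}$. *)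

(* Defs.v *)
From HB Require Import structures.
From mathcomp Require Import all_boot all_order all_algebra.
From mathcomp Require Import complex mxtens.
From mathcomp Require Import all_classical all_reals all_analysis.

Set Implicit Arguments.
Unset Strict Implicit.
Unset Printing Implicit Defensive.

Import Order.TTheory GRing.Theory Num.Theory.
Import numFieldNormedType.Exports.

Local Open Scope classical_set_scope.
Local Open Scope ring_scope.

Notation "A *t B" := (tensmx A B)
  (at level 40, left associativity, format "A  *t  B") : ring_scope.

(* Indices s, t in {1, ..., N} are represented by s, t : 'I_N starting at 0.
   Hence omega^(s-1) becomes omega ^+ s, omega^(1-s) becomes omega ^ (- s), and
   exponents depending only on s - t are unchanged. Similarly e_{11}, e_{12},
   ... are delta_mx 0 0, delta_mx 0 1, ...
   M_2 (x) M_N is 'M_(2 * N) and M_2N (x) M_2N is 'M_(2 * N * (2 * N)), both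
   through the Kronecker product *t of mxtens. *)

Definition cexp (R : realType) (x : R[i]) : R[i] :=
  Complex (expR (complex.Re x) * cos (complex.Im x))
          (expR (complex.Re x) * sin (complex.Im x)).

Section Factors.
Variables (R : realType) (N : nat).

(* R[i]^o carries the topology of the modulus; the infinite sum is the limit of
   its partial sums in that topology. *)
Definition Afun (q x : R[i]) : R[i] :=
  cexp (- limn (fun n => \sum_(1 <= k < n)
    (x ^+ k * (q ^+ k - q ^- k) / (k%:R * (q ^+ k + q ^- k)) : R[i]^o))).

Definition e_ (i j : 'I_2) : 'M[R[i]]_2 := delta_mx i j.
Definition eps_ (s t : 'I_N) : 'M[R[i]]_N := delta_mx s t.

(* ordS is the cyclic successor, so the last term is epsilon_{N,1}. *)
Definition Cmx : 'M[R[i]]_N := \sum_(t < N) eps_ t (ordS t).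

Variables (omega q r : R[i]).

Definition Dmx : 'M[R[i]]_N := \sum_(s < N) omega ^+ s *: eps_ s s.
Definition Pmx : 'M[R[i]]_N :=
  \sum_(s < N) \sum_(t < N) omega ^+ (s * t)%N *: eps_ s t.
Definition Pacute : 'M[R[i]]_(2 * N) := 1%:M *t Pmx.

Definition R_1 (z : R[i]) : 'M[R[i]]_(2 * N * (2 * N)) :=
  1%:M - ((q ^+ 2 - 1) * q^-1 / (1 - z ^+ N)) *:
    \sum_(n < N) (z * omega) ^+ n *:
      ((e_ 0 1 *t (Dmx *m Cmx ^+ n)) *t (e_ 1 0 *t invmx (Cmx ^+ n))).

Definition R_0 (z : R[i]) : 'M[R[i]]_(2 * N * (2 * N)) :=
  1%:M - (z * (q ^+ 2 - 1) * q^-1 / (1 - z ^+ N)) *: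
    \sum_(n < N) z ^+ n *:
      ((e_ 1 0 *t (invmx Dmx *m Cmx ^+ n.+1))
         *t (e_ 0 1 *t invmx (Cmx ^+ n.+1))).

Definition R_delta (z : R[i]) : 'M[R[i]]_(2 * N * (2 * N)) :=
  (Pacute *t Pacute) *m
  (\sum_(s < N) \sum_(t < N)
    (Afun q (z * omega ^ (s%:Z - t%:Z + 1)) *:
       ((e_ 0 0 *t eps_ s s) *t (e_ 0 0 *t eps_ t t))
     + (Afun q (z * q ^- 2 * omega ^ (s%:Z - t%:Z)))^-1 *:
       ((e_ 0 0 *t eps_ s s) *t (e_ 1 1 *t eps_ t t))
     + (Afun q (z * q ^+ 2 * omega ^ (s%:Z - t%:Z + 1)))^-1 *:
       ((e_ 1 1 *t eps_ s s) *t (e_ 0 0 *t eps_ t t))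
     + Afun q (z * omega ^ (s%:Z - t%:Z)) *:
       ((e_ 1 1 *t eps_ s s) *t (e_ 1 1 *t eps_ t t)))) *m
  (invmx Pacute *t invmx Pacute).

(* r plays the role of q^(1/2). *)
Definition R_h : 'M[R[i]]_(2 * N * (2 * N)) :=
  \sum_(s < N) \sum_(t < N)
    ((r^-1 * omega ^ (t%:Z - s%:Z)) *:
       ((e_ 0 0 *t eps_ s s) *t (e_ 0 0 *t eps_ t t))
     + (r * omega ^+ t) *:
       ((e_ 0 0 *t eps_ s s) *t (e_ 1 1 *t eps_ t t))
     + (r * omega ^ (- s%:Z)) *:
       ((e_ 1 1 *t eps_ s s) *t (e_ 0 0 *t eps_ t t))
     + r^-1 *:
       ((e_ 1 1 *t eps_ s s) *t (e_ 1 1 *t eps_ t t))).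

Definition Rmx (z : R[i]) : 'M[R[i]]_(2 * N * (2 * N)) :=
  R_1 z *m R_delta z *m R_0 z *m R_h.

End Factors.

Section Legs.
Variables (K : comNzRingType) (d : nat).

(* The linear extension of m (x) m' |-> f m m', for f bilinear, computed from
   M = \sum M_((i, k), (j, l)) E_ij (x) E_kl. *)
Definition tens_lift (p : nat) (f : 'M[K]_d -> 'M[K]_d -> 'M[K]_p)
    (M : 'M[K]_(d * d)) : 'M[K]_p :=
  \sum_(i < d) \sum_(j < d) \sum_(k < d) \sum_(l < d)
    M (mxtens_index (i, k)) (mxtens_index (j, l)) *:
      f (delta_mx i j) (delta_mx k l).

Definition leg12 : 'M[K]_(d * d) -> 'M[K]_(d * d * d) :=
  tens_lift (fun m m' => m *t m' *t 1%:M).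
Definition leg13 : 'M[K]_(d * d) -> 'M[K]_(d * d * d) :=
  tens_lift (fun m m' => m *t 1%:M *t m').
Definition leg23 : 'M[K]_(d * d) -> 'M[K]_(d * d * d) :=
  tens_lift (fun m m' => 1%:M *t m *t m').

Lemma tens_liftE p (f : 'M[K]_d -> 'M[K]_d -> 'M[K]_p) (A B : 'M[K]_d) :
    (forall X, linear (f X)) -> (forall Y, linear (f^~ Y)) ->
  tens_lift f (A *t B) = f A B.
Proof.
move=> lr ll.
pose fr X : {linear _ -> _} := HB.pack (f X) (GRing.isLinear.Build _ _ _ _ _ (lr X)).
pose fl Y : {linear _ -> _} := HB.pack (f^~ Y) (GRing.isLinear.Build _ _ _ _ _ (ll Y)).
have -> : f A B = fl B A by [].
rewrite {2}(matrix_sum_delta A) linear_sum; apply: eq_bigr => i _.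
rewrite linear_sum; apply: eq_bigr => j _; rewrite linearZ /=.
have -> : f (delta_mx i j) B = fr (delta_mx i j) B by [].
rewrite {2}(matrix_sum_delta B) linear_sum scaler_sumr; apply: eq_bigr => k _.
rewrite linear_sum scaler_sumr; apply: eq_bigr => l _.
by rewrite linearZ /= scalerA tensmxE.
Qed.

End Legs.

(* Main.v *)
Require Import Defs.
From mathcomp Require Import all_boot all_order all_algebra.
From mathcomp Require Import complex mxtens ring lra.
From mathcomp Require Import all_classical all_reals all_analysis.

(** Conjugation by the discrete Fourier matrix P turns C into the diagonal
    matrix D and D into the inverse shift C^-1. Hence, after conjugation by
    P on every tensor leg, R(z) acts on functions f (i, a) (j, b) of two spins
    i, j and two positions a, b in Z/N, and it touches the positions only by
    shifts and by multiplication with functions of omega^(a-b): the geometric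
    sums over n in R_1 and R_0 become the fractions 1/(1 - x) and x/(1 - x),
    where x is z times a power of omega, and R_delta becomes diagonal.

    Write x = z omega^(a-b), up to a shift of a - b. The function A satisfies
    A(x) A(q^2 x) = (1 - q^2 x) / (1 - x) [AfunM], so every entry of R_delta is
    A(x) times a rational function of x, and the product of the four factors
    collapses [factored_op] to the six-vertex weight at the parameter x, up to
    the scalar A(x) / (q^(1/2) (1 - q^2 x)), composed with a shift of the
    positions: the second position moves with the incoming first spin and the
    first one with the outgoing second spin [twisted_op].

    The six-vertex weight satisfies the Yang-Baxter equation [six_vertex_ybe],
    a polynomial identity checked on the eight spin configurations. The shift
    is an abelian twist: the six-vertex weight conserves the sum of its two
    spins, so all shifts can be moved through it until both sides are six-vertex
    products with the parameters x, x y, y, applied to one and the same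
    shifted function [twisted_op_ybe]. Undoing the Fourier conjugation gives
    the equation for R itself [ybe_of_intertwine].

    The equation for A is where analysis enters. Adding the series for x and
    for q^2 x cancels the denominators q^k + q^-k and leaves the difference of
    two logarithmic series, and exp(- sum x^k / k) = 1 - x [cexp_log]. The
    hypothesis on q keeps these denominators nonzero and the coefficients of
    the series bounded [cosh_regularP]. *)

Import Order.TTheory GRing.Theory Num.Theory.
Local Open Scope ring_scope.

Set Implicit Arguments.
Unset Strict Implicit.
Unset Printing Implicit Defensive.

(** * The six-vertex Yang-Baxter equation and its twist *)

Section SixVertex.
Variable K : fieldType.
Variables (q : K) (rho : K -> K).

(** The six-vertex R-matrix in row form: the value at the outgoing spins
    (i, j) of its action on a function g of the incoming spins. The factor rho
    is an arbitrary normalization; the two off-diagonal entries differ by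
    the factor x (homogeneous gauge). *)
Definition six_vertex (x : K) (g : 'I_2 -> 'I_2 -> K) (i j : 'I_2) : K :=
  rho x * (if i == j then (1 - q ^+ 2 * x) * g i j
           else q * (1 - x) * g i j
                + (1 - q ^+ 2) * (if i == 0 then 1 else x) * g j i).

(** Spin conservation: only the spins (i, j) and (j, i), which have the same
    sum, contribute to the value at (i, j). *)
Lemma six_vertex_local x g g' i j :
  g i j = g' i j -> g j i = g' j i ->
  six_vertex x g i j = six_vertex x g' i j.
Proof. by rewrite /six_vertex => -> ->. Qed.

Lemma ord2P (P : 'I_2 -> Prop) : P 0 -> P 1 -> forall i, P i.
Proof.
move=> P0 P1 [[|[|//]] lt_i].
- by rewrite (_ : Ordinal lt_i = 0) //; exact: val_inj.
- by rewrite (_ : Ordinal lt_i = 1) //; exact: val_inj.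
Qed.

Lemma six_vertex_ybe x y g i j k :
  six_vertex x (fun i1 j1 => six_vertex (x * y) (fun i2 k1 =>
    six_vertex y (fun j2 k2 => g i2 j2 k2) j1 k1) i1 k) i j =
  six_vertex y (fun j1 k1 => six_vertex (x * y) (fun i1 k2 =>
    six_vertex x (fun i2 j2 => g i2 j2 k2) i1 j1) i k1) j k.
Proof.
by rewrite /six_vertex; elim/ord2P: i; elim/ord2P: j; elim/ord2P: k => /=; ring.
Qed.

End SixVertex.

Section Twist.
Variables (K : fieldType) (G : zmodType) (chi : G -> K) (tau : G).
Hypothesis chiD : forall a b, chi (a + b) = chi a * chi b.
Variables (q : K) (rho : K -> K).

(** The amount by which a spin displaces the position on the other leg. *)
Definition shift (i : 'I_2) : G := if i == 0 then tau else 0.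

(** With F f (s, t) = f (s, t - shift s.1) and F' its flip, this is
    F'^-1 o W o F, where W is the six-vertex operator whose parameter
    z chi (a - b) is read off the positions between the two shifts. *)
Definition twisted_op (z : K) (f : 'I_2 * G -> 'I_2 * G -> K)
    (s t : 'I_2 * G) : K :=
  six_vertex q rho (z * chi (s.2 + shift t.1 - t.2))
    (fun i j => f (i, s.2 + shift t.1) (j, t.2 - shift i)) s.1 t.1.

(** Both sides equal the six-vertex products with parameters x and y applied
    to the function g, which carries the accumulated shifts: by conservation, the
    shifts met inside the product depend only on the total of the spins
    entering the vertices, and so can be expressed by outer spins. *)
Lemma twisted_op_ybe z w (f : 'I_2 * G -> 'I_2 * G -> 'I_2 * G -> K) s t u :
  twisted_op z (fun s1 t1 => twisted_op (z * w) (fun s2 u1 =>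
    twisted_op w (fun t2 u2 => f s2 t2 u2) t1 u1) s1 u) s t =
  twisted_op w (fun t1 u1 => twisted_op (z * w) (fun s1 u2 =>
    twisted_op z (fun s2 t2 => f s2 t2 u2) s1 t1) s u1) t u.
Proof.
case: s t u => [i a] [j b] [k c]; rewrite /twisted_op /=.
pose x := z * chi (a + shift j - b).
pose y := w * chi (b + shift k - c).
have xyE : z * w * chi (a + shift j + shift k - c) = x * y.
  rewrite mulrACA -chiD; congr (_ * chi _).
  by rewrite -[b + _ - c]addrA subrKA addrA.
pose g i1 j1 k1 := f (i1, a + shift j + shift k)
  (j1, b + shift k - shift i1) (k1, c - shift i1 - shift j1).
transitivity (six_vertex q rho x (fun i1 j1 => six_vertex q rho (x * y)
  (fun i2 k1 => six_vertex q rho y (fun j2 k2 => g i2 j2 k2) j1 k1) i1 k) i j).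
  congr six_vertex; apply/funext => i1; apply/funext => j1; rewrite xyE.
  (* The middle vertex sends the spins (i1, k) to (i2, k1), of equal total. *)
  have move i2 k1 : shift i1 + shift k = shift i2 + shift k1 ->
      b - shift i1 + shift k1 = b + shift k - shift i2.
    by move=> /(canRL (addKr _)) ->; rewrite [shift i2 + _]addrC !addrA addrK.
  have inner i2 k1 : shift i1 + shift k = shift i2 + shift k1 ->
    six_vertex q rho (w * chi (b - shift i1 + shift k1 - (c - shift i2)))
      (fun j2 k2 => f (i2, a + shift j + shift k)
        (j2, b - shift i1 + shift k1) (k2, c - shift i2 - shift j2)) j1 k1 =
    six_vertex q rho y (fun j2 k2 => g i2 j2 k2) j1 k1.
    move=> /move ->; rewrite /y /g; congr (six_vertex _ _ (_ * chi _)).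
    by rewrite opprB addrA subrK.
  by apply: six_vertex_local; apply: inner; rewrite // addrC.
rewrite six_vertex_ybe; apply/esym.
(* Here conservation is used twice: at the vertex (j, k) and, inside, at (i1, j1). *)
have inner j1 k1 : shift j + shift k = shift j1 + shift k1 ->
  six_vertex q rho (z * w * chi (a + shift k1 - (c - shift j1)))
    (fun i1 k2 =>
       six_vertex q rho (z * chi (a + shift k1 + shift j1 - (b + shift k)))
         (fun i2 j2 => f (i2, a + shift k1 + shift j1)
            (j2, b + shift k - shift i2) (k2, c - shift j1 - shift i1)) i1 j1)
    i k1 =
  six_vertex q rho (x * y) (fun i1 k2 =>
    six_vertex q rho x (fun i2 j2 => g i2 j2 k2) i1 j1) i k1.
  move=> h; have {}h : a + shift k1 + shift j1 = a + shift j + shift k.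
    by rewrite -addrA [shift k1 + _]addrC -h addrA.
  rewrite opprB addrA h xyE.
  congr six_vertex; apply/funext => i1; apply/funext => k2.
  rewrite opprD addrA [_ - b - _]addrAC addrK -/x.
  have sub2 i2 j2 : shift i1 + shift j1 = shift i2 + shift j2 ->
      c - shift j1 - shift i1 = c - shift i2 - shift j2.
    by move=> e; rewrite -!addrA -!opprD [shift j1 + _]addrC e.
  by apply: six_vertex_local; rewrite /g; congr f; congr pair; apply: sub2;
    rewrite // addrC.
by apply: six_vertex_local; apply: inner; rewrite // addrC.
Qed.
End Twist.

(** * Collapse of the four factors to a six-vertex weight *)

Section Scalars.
Variables (K : fieldType) (G : zmodType) (chi : G -> K) (tau : G).
Variables (q r : K) (A : K -> K).
Local Notation site := ('I_2 * G)%type.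
Implicit Types (f : site -> site -> K) (s t : site).

(** The shape of R_1 in the Fourier basis, where every coefficient depends on
    the difference of the positions only; the next three operators are the shapes
    of R_0, R_delta and R_h. *)
Definition raise_op (c : G -> K) f s t : K :=
  f s t - ((s.1 == 0) && (t.1 == 1))%:R *
    (c (s.2 - t.2) * f (1, s.2 - tau) (0, t.2)).

Definition lower_op (c : G -> K) f s t : K :=
  f s t - ((s.1 == 1) && (t.1 == 0))%:R *
    (c (s.2 - t.2) * f (0, s.2 + tau) (1, t.2)).

Definition diagonal_op (c : 'I_2 -> 'I_2 -> G -> K) f s t : K :=
  c s.1 t.1 (s.2 - t.2) * f s t.

Definition shift_op f s t : K :=
  (if s.1 == t.1 then r^-1 else r) *
    f (s.1, s.2 + shift tau t.1) (t.1, t.2 - shift tau s.1).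

Variable z : K.

Definition delta_weight (i j : 'I_2) (a : G) : K :=
  if i == 0 then if j == 0 then A (z * chi (a + tau)) else (A (z * q ^- 2 * chi a))^-1
  else if j == 0 then (A (z * q ^+ 2 * chi (a + tau)))^-1 else A (z * chi a).

(** The factor rho for which the six-vertex weight reproduces R(z); 1 / A(q^2 x)
    and 1 / A(q^-2 x) being rational multiples of A(x), it absorbs all values of A. *)
Definition six_vertex_norm (x : K) : K := r^-1 * A x / (1 - q ^+ 2 * x).

(** On spins (0, 1) the product of the raising and the lowering term adds to the
    diagonal entry, and the identity
    (1 - x q^2) (1 - x q^-2) + (q - q^-1)^2 x = (1 - x)^2
    makes the sum the six-vertex weight; the other entries match one by one. *)
Lemma factored_op f s t :
  r ^+ 2 = q -> q != 0 ->
  (forall a, let x := z * chi a in [/\ 1 - x != 0, 1 - q ^+ 2 * x != 0,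
     (A (x * q ^+ 2))^-1 = A x * (1 - x) / (1 - q ^+ 2 * x) &
     (A (x * q ^- 2))^-1 = A x * (1 - x * q ^- 2) / (1 - x)]) ->
  raise_op (fun a => (q - q^-1) / (1 - z * chi a))
    (diagonal_op delta_weight
      (lower_op (fun a => (q - q^-1) * (z * chi (a + tau)) / (1 - z * chi (a + tau)))
        (shift_op f))) s t =
  twisted_op chi tau q six_vertex_norm z f s t.
Proof.
case: s t => [i a] [j b] rq q0 H.
have r0 : r != 0 by apply: contraNneq q0 => r0; rewrite -rq r0 expr0n.
have [x1 x2 Aq AqV] := H (a - b).
have [y1 y2 _ _] := H (a - b + tau).
have subA : a + tau - b = a - b + tau by rewrite addrAC.
rewrite /raise_op /diagonal_op /lower_op /shift_op /twisted_op /six_vertex /=.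
rewrite /six_vertex_norm /delta_weight.
rewrite [z * q ^- 2 * _]mulrAC.
elim/ord2P: i; elim/ord2P: j; rewrite /shift /= ?(mul0r, mul1r, subr0, addr0).
- by rewrite subA; field; rewrite r0 y2.
- rewrite AqV [a - tau - b]addrAC !subrK [z * q ^+ 2 * _]mulrAC Aq -rq.
  rewrite -rq -exprM in x2; move: x1 x2; set x := z * _ => x1 x2.
  by field; rewrite r0 x1 x2.
- rewrite [z * q ^+ 2 * _]mulrAC.
  have [_ _ Bq _] := H (a - b + tau).
  rewrite Bq subA -rq; rewrite -rq -exprM in y2; move: y1 y2; set x := z * _ => y1 y2.
  by field; rewrite r0 y1 y2.
- by field; rewrite x2 r0.
Qed.

End Scalars.

(** * Tensor products and legs acting on functions *)

Section Action.
Variables (K : fieldType) (N : nat).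
Local Notation site := ('I_2 * 'I_N)%type.
Local Notation d := (2 * N)%N.
Implicit Types (s t u : site).

Lemma sum_only (I : finType) (x : I) (F : I -> K) :
  (forall i, i != x -> F i = 0) -> \sum_i F i = F x.
Proof. by move=> F0; rewrite (bigD1 x) //= big1 ?addr0. Qed.

Lemma sum_mxtens m n (F : 'I_(m * n) -> K) :
  \sum_k F k = \sum_i \sum_j F (mxtens_index (i, j)).
Proof.
rewrite pair_bigA (reindex (@mxtens_index m n)) /=.
  by apply: eq_bigr => -[].
by exists (@mxtens_unindex m n) => k _; rewrite ?mxtens_indexK ?mxtens_unindexK.
Qed.

(** Vectors of the tensor powers are handled as functions of (spin, position)
    pairs; idx, idx2 and idx3 translate such pairs into matrix indices. *)
Definition idx (s : site) : 'I_d := mxtens_index s.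
Definition idx2 s t : 'I_(d * d) := mxtens_index (idx s, idx t).
Definition idx3 s t u : 'I_(d * d * d) := mxtens_index (idx2 s t, idx u).

Lemma sum_idx (F : 'I_d -> K) : \sum_k F k = \sum_s F (idx s).
Proof. by rewrite sum_mxtens pair_bigA; apply: eq_bigr => -[]. Qed.

Lemma sum_idx2 (F : 'I_(d * d) -> K) : \sum_k F k = \sum_s \sum_t F (idx2 s t).
Proof.
by rewrite sum_mxtens sum_idx; apply: eq_bigr => s _; rewrite sum_idx.
Qed.

Lemma sum_idx3 (F : 'I_(d * d * d) -> K) :
  \sum_k F k = \sum_s \sum_t \sum_u F (idx3 s t u).
Proof.
rewrite sum_mxtens sum_idx2.
by apply: eq_bigr => s _; apply: eq_bigr => t _; rewrite sum_idx.
Qed.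

Lemma idx_inj : injective idx.
Proof. exact: can_inj (@mxtens_indexK 2 N). Qed.

Lemma idx2_inj s t s' t' : (idx2 s t == idx2 s' t') = (s == s') && (t == t').
Proof.
by rewrite (inj_eq (can_inj (@mxtens_indexK _ _))) xpair_eqE !(inj_eq idx_inj).
Qed.

Definition act2 (M : 'M[K]_(d * d)) (f : site -> site -> K) s t : K :=
  \sum_s' \sum_t' M (idx2 s t) (idx2 s' t') * f s' t'.

Definition act3 (M : 'M[K]_(d * d * d)) (f : site -> site -> site -> K) s t u : K :=
  \sum_s' \sum_t' \sum_u' M (idx3 s t u) (idx3 s' t' u') * f s' t' u'.

Lemma act2M M M' f : act2 (M *m M') f = act2 M (act2 M' f).
Proof.
have flat (F : site -> site -> K) :
  \sum_s \sum_t F s t = \sum_(p : site * site) F p.1 p.2 by rewrite pair_bigA.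
apply/funext => s; apply/funext => t; rewrite /act2 !flat.
under [LHS]eq_bigr do rewrite mxE mulr_suml sum_idx2 flat.
under [RHS]eq_bigr do rewrite flat mulr_sumr.
rewrite exchange_big; apply: eq_bigr => p _; apply: eq_bigr => p' _ /=.
by rewrite mulrA.
Qed.

(** Composes four actions whose explicit forms are known, in the order in which
    the four factors of R(z) occur. *)
Lemma act2_factors M1 M2 M3 M4
    (F1 F2 F3 F4 : (site -> site -> K) -> site -> site -> K) f :
  (forall g, act2 M1 g = F1 g) -> (forall g, act2 M2 g = F2 g) ->
  (forall g, act2 M3 g = F3 g) -> (forall g, act2 M4 g = F4 g) ->
  act2 (M1 *m M2 *m M3 *m M4) f = F1 (F2 (F3 (F4 f))).
Proof. by move=> h1 h2 h3 h4; rewrite !act2M h4 h3 h2 h1. Qed.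

Lemma act3M M M' f : act3 (M *m M') f = act3 M (act3 M' f).
Proof.
have flat (F : site -> site -> site -> K) : \sum_s \sum_t \sum_u F s t u =
    \sum_(p : site * site * site) F p.1.1 p.1.2 p.2.
  by rewrite pair_bigA pair_bigA.
apply/funext => s; apply/funext => t; apply/funext => u.
rewrite /act3 !flat.
under [LHS]eq_bigr do rewrite mxE mulr_suml sum_idx3 flat.
under [RHS]eq_bigr do rewrite flat mulr_sumr.
rewrite exchange_big; apply: eq_bigr => p _; apply: eq_bigr => p' _ /=.
by rewrite mulrA.
Qed.

(** Indicator functions pick out the matrix entries, so it is enough to compare
    actions. *)
Lemma act3_inj M M' : (forall f s t u, act3 M f s t u = act3 M' f s t u) -> M = M'.
Proof.
move=> e; apply/matrixP => k l.
case: (mxtens_indexP k) => [k12 k3]; case: (mxtens_indexP l) => [l12 l3].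
case: (mxtens_indexP k12) => k1 k2; case: (mxtens_indexP l12) => l1 l2.
rewrite -(mxtens_unindexK k1) -(mxtens_unindexK k2) -(mxtens_unindexK k3).
rewrite -(mxtens_unindexK l1) -(mxtens_unindexK l2) -(mxtens_unindexK l3).
move: (mxtens_unindex k1) (mxtens_unindex k2) (mxtens_unindex k3) => s t u.
move: (mxtens_unindex l1) (mxtens_unindex l2) (mxtens_unindex l3) => s0 t0 u0.
have pick (L : 'M[K]_(d * d * d)) :
    act3 L (fun s' t' u' => ((s' == s0) && (t' == t0) && (u' == u0))%:R) s t u =
    L (idx3 s t u) (idx3 s0 t0 u0).
  rewrite /act3 (sum_only (x := s0)) => [|s' /negbTE ->]; last first.
    by rewrite big1 // => t' _; rewrite big1 // => u' _; rewrite mulr0.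
  rewrite (sum_only (x := t0)) => [|t' /negbTE ->]; last first.
    by rewrite big1 // => u' _; rewrite andbF mulr0.
  rewrite (sum_only (x := u0)) => [|u' /negbTE ->]; last by rewrite andbF mulr0.
  by rewrite !eqxx mulr1.
by rewrite -[LHS]pick -[RHS]pick e.
Qed.

Lemma act2D M M' f s t : act2 (M + M') f s t = act2 M f s t + act2 M' f s t.
Proof.
rewrite /act2 -big_split; apply: eq_bigr => s' _.
by rewrite -big_split; apply: eq_bigr => t' _; rewrite mxE mulrDl.
Qed.

Lemma act2Z c M f s t : act2 (c *: M) f s t = c * act2 M f s t.
Proof.
rewrite /act2 mulr_sumr; apply: eq_bigr => s' _.
by rewrite mulr_sumr; apply: eq_bigr => t' _; rewrite mxE mulrA.
Qed.

Lemma act2_comb4 c1 c2 c3 c4 M1 M2 M3 M4 f s t :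
  act2 (c1 *: M1 + c2 *: M2 + c3 *: M3 + c4 *: M4) f s t =
  c1 * act2 M1 f s t + c2 * act2 M2 f s t + c3 * act2 M3 f s t
  + c4 * act2 M4 f s t.
Proof. by rewrite 3!act2D !act2Z. Qed.

Lemma act2N M f s t : act2 (- M) f s t = - act2 M f s t.
Proof. by rewrite -scaleN1r act2Z mulN1r. Qed.

Lemma act2_sum I (r : seq I) (F : I -> 'M[K]_(d * d)) f s t :
  act2 (\sum_(i <- r) F i) f s t = \sum_(i <- r) act2 (F i) f s t.
Proof.
apply: (big_morph (fun M => act2 M f s t)) => [M M'|]; first exact: act2D.
by rewrite /act2 big1 // => s' _; rewrite big1 // => t' _; rewrite mxE mul0r.
Qed.

Lemma act21 f s t : act2 1%:M f s t = f s t.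
Proof.
rewrite /act2 (sum_only (x := s)) => [|s' ns]; last first.
  by rewrite big1 // => t' _; rewrite mxE idx2_inj eq_sym (negbTE ns) mul0r.
rewrite (sum_only (x := t)) => [|t' nt]; last first.
  by rewrite mxE idx2_inj andbC eq_sym (negbTE nt) mul0r.
by rewrite mxE eqxx mul1r.
Qed.

(** The four sums in the definition of the linear extension collapse to the term
    of the matrix units that meet the given row and column. *)
Lemma tens_lift_entry p (f : 'M[K]_d -> 'M[K]_d -> 'M[K]_p) (M : 'M[K]_(d * d))
    (k l : 'I_p) s t s' t' (c : K) :
  (forall i j i' j', f (delta_mx i i') (delta_mx j j') k l =
     ((idx s == i) && (idx s' == i'))%:R * ((idx t == j) && (idx t' == j'))%:R * c) ->
  tens_lift f M k l = M (idx2 s t) (idx2 s' t') * c.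
Proof.
move=> fE; rewrite /tens_lift summxE (sum_only (x := idx s)); last first.
  move=> i ni; rewrite summxE big1 // => i' _; rewrite summxE big1 // => j _.
  rewrite summxE big1 // => j' _.
  by rewrite mxE fE eq_sym (negbTE ni) !mul0r mulr0.
rewrite summxE (sum_only (x := idx s')); last first.
  move=> i' ni; rewrite summxE big1 // => j _; rewrite summxE big1 // => j' _.
  by rewrite mxE fE [idx s' == _]eq_sym (negbTE ni) andbF !mul0r mulr0.
rewrite summxE (sum_only (x := idx t)); last first.
  move=> j nj; rewrite summxE big1 // => j' _.
  by rewrite mxE fE [idx t == _]eq_sym (negbTE nj) mulr0 mul0r mulr0.
rewrite summxE (sum_only (x := idx t')); last first.
  by move=> j' nj; rewrite mxE fE [idx t' == _]eq_sym (negbTE nj) andbF mulr0 mul0r mulr0.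
by rewrite mxE fE !eqxx !mul1r.
Qed.

Lemma act3_leg12 M f s t u :
  act3 (leg12 M) f s t u = act2 M (fun s' t' => f s' t' u) s t.
Proof.
rewrite /act3 /act2; apply: eq_bigr => s' _; apply: eq_bigr => t' _.
have E u' : leg12 M (idx3 s t u) (idx3 s' t' u') =
    M (idx2 s t) (idx2 s' t') * (u == u')%:R.
  by apply: tens_lift_entry => i j i' j'; rewrite !tensmxE !mxE (inj_eq idx_inj).
rewrite (sum_only (x := u)) => [|u' nu]; first by rewrite E eqxx mulr1.
by rewrite E eq_sym (negbTE nu) mulr0 mul0r.
Qed.

Lemma act3_leg13 M f s t u :
  act3 (leg13 M) f s t u = act2 M (fun s' u' => f s' t u') s u.
Proof.
rewrite /act3 /act2; apply: eq_bigr => s' _; rewrite exchange_big.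
apply: eq_bigr => u' _.
have E t' : leg13 M (idx3 s t u) (idx3 s' t' u') =
    M (idx2 s u) (idx2 s' u') * (t == t')%:R.
  apply: tens_lift_entry => i j i' j'; rewrite !tensmxE !mxE (inj_eq idx_inj).
  by rewrite mulrAC.
rewrite (sum_only (x := t)) => [|t' nt]; first by rewrite E eqxx mulr1.
by rewrite E eq_sym (negbTE nt) mulr0 mul0r.
Qed.

Lemma act3_leg23 M f s t u :
  act3 (leg23 M) f s t u = act2 M (fun t' u' => f s t' u') t u.
Proof.
have E s' t' u' : leg23 M (idx3 s t u) (idx3 s' t' u') =
    M (idx2 t u) (idx2 t' u') * (s == s')%:R.
  apply: tens_lift_entry => i j i' j'; rewrite !tensmxE !mxE (inj_eq idx_inj).
  by rewrite -mulrA mulrC.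
rewrite /act3 /act2 (sum_only (x := s)) => [|s' ns]; last first.
  rewrite big1 // => t' _; rewrite big1 // => u' _.
  by rewrite E eq_sym (negbTE ns) mulr0 mul0r.
by apply: eq_bigr => t' _; apply: eq_bigr => u' _; rewrite E eqxx mulr1.
Qed.

(** In each row, a single entry may be nonzero: A multiplies a function by g
    after composing it with sigma. All powers of C and D are of this kind. *)
Definition monomial_mx (A : 'M[K]_N) (g : 'I_N -> K) (sigma : 'I_N -> 'I_N) :=
  forall a b, A a b = if b == sigma a then g a else 0.

Lemma act2_monomial (i i' j j' : 'I_2) A B g h sigma pi f s t :
  monomial_mx A g sigma -> monomial_mx B h pi ->
  act2 ((delta_mx i i' *t A) *t (delta_mx j j' *t B)) f s t =
  ((s.1 == i) && (t.1 == j))%:R *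
    (g s.2 * h t.2 * f (i', sigma s.2) (j', pi t.2)).
Proof.
case: s t => [i0 a] [j0 b] Am Bm /=.
have E s' t' : ((delta_mx i i' *t A) *t (delta_mx j j' *t B))
     (idx2 (i0, a) (j0, b)) (idx2 s' t') =
   ((i0 == i) && (s'.1 == i'))%:R * A a s'.2 * (((j0 == j) && (t'.1 == j'))%:R * B b t'.2).
  by case: s' t' => [? ?] [? ?]; rewrite !tensmxE !mxE.
rewrite /act2 (sum_only (x := (i', sigma a))) => [|[k c] nk]; last first.
  rewrite big1 // => t' _; rewrite E Am /=.
  move: nk; rewrite xpair_eqE negb_and => /orP[]/negbTE ->; first by rewrite andbF !mul0r.
  by rewrite mulr0 !mul0r.
rewrite (sum_only (x := (j', pi b))) => [|[k c] nk]; last first.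
  rewrite E Bm /=.
  move: nk; rewrite xpair_eqE negb_and => /orP[]/negbTE ->.
    by rewrite andbF !mul0r mulr0 mul0r.
  by rewrite !mulr0 mul0r.
rewrite E Am Bm /= !eqxx !andbT.
case: eqP => _; case: eqP => _ /=; rewrite ?(mul0r, mul1r, mulr0) //.
Qed.

Lemma monomialM A B g h sigma pi : monomial_mx A g sigma -> monomial_mx B h pi ->
  monomial_mx (A *m B) (fun a => g a * h (sigma a)) (pi \o sigma).
Proof.
move=> Am Bm a b; rewrite mxE (sum_only (x := sigma a)) => [|c /negbTE nc].
  by rewrite Am Bm eqxx /=; case: eqP; rewrite ?mulr0.
by rewrite Am nc mul0r.
Qed.

Lemma monomial1 : monomial_mx 1%:M (fun => 1) id.
Proof. by move=> a b; rewrite mxE eq_sym; case: eqP. Qed.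

(** The shape of R_1 and R_0 in the Fourier basis: once the matrices on the
    positions are monomial, the sum over powers becomes a scalar. *)
Lemma act2_exchange m (c : K) (v : nat -> K) (i0 i1 j0 j1 : 'I_2)
    (X Y : nat -> 'M[K]_N) (g h : nat -> 'I_N -> K) sigma f i j a b :
  (forall k, monomial_mx (X k) (g k) sigma) ->
  (forall k, monomial_mx (Y k) (h k) id) ->
  act2 (1%:M - c *: \sum_(k < m) v k *:
    ((delta_mx i0 i1 *t X k) *t (delta_mx j0 j1 *t Y k))) f (i, a) (j, b) =
  f (i, a) (j, b) - ((i == i0) && (j == j0))%:R *
    (c * (\sum_(k < m) v k * g k a * h k b) * f (i1, sigma a) (j1, b)).
Proof.
move=> Xm Ym; rewrite act2D act2N act21 act2Z act2_sum; congr (_ - _).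
rewrite -[in RHS]mulrA mulrCA; congr (_ * _).
rewrite mulr_suml mulr_sumr; apply: eq_bigr => k _.
by rewrite act2Z (act2_monomial _ _ _ _ _ _ _ (Xm k) (Ym k)) /= mulrCA !mulrA.
Qed.

Lemma act2_diagonal (A00 A01 A10 A11 : 'I_N -> 'I_N -> K) f i j a b :
  act2 (\sum_(s < N) \sum_(t < N)
    (A00 s t *: ((delta_mx 0 0 *t delta_mx s s) *t (delta_mx 0 0 *t delta_mx t t))
   + A01 s t *: ((delta_mx 0 0 *t delta_mx s s) *t (delta_mx 1 1 *t delta_mx t t))
   + A10 s t *: ((delta_mx 1 1 *t delta_mx s s) *t (delta_mx 0 0 *t delta_mx t t))
   + A11 s t *: ((delta_mx 1 1 *t delta_mx s s) *t (delta_mx 1 1 *t delta_mx t t))))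
    f (i, a) (j, b) =
  (if i == 0 then if j == 0 then A00 a b else A01 a b
   else if j == 0 then A10 a b else A11 a b) * f (i, a) (j, b).
Proof.
have me (s : 'I_N) : monomial_mx (delta_mx s s) (fun c => (c == s)%:R) id.
  move=> c c'; rewrite mxE; have [->|nc] := eqVneq c' c; first by rewrite andbb.
  by case: eqVneq => //= e; rewrite -e (negbTE nc).
have act_eps k k' (s t : 'I_N) :
    act2 ((delta_mx k k *t delta_mx s s) *t (delta_mx k' k' *t delta_mx t t))
      f (i, a) (j, b) =
    ((i == k) && (j == k'))%:R * ((a == s) && (b == t))%:R * f (k, a) (k', b).
  rewrite (act2_monomial _ _ _ _ _ _ _ (me s) (me t)) /=.
  by rewrite -[RHS]mulrA; congr (_ * _); case: (a == s); rewrite /= ?mul1r ?mul0r.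
rewrite act2_sum (sum_only (x := a)) => [|s /negbTE ns]; last first.
  rewrite act2_sum big1 // => t _; rewrite act2_comb4 !act_eps [a == s]eq_sym ns.
  by rewrite !(mulr0, mul0r) !addr0.
rewrite act2_sum (sum_only (x := b)) => [|t /negbTE nt]; last first.
  rewrite act2_comb4 !act_eps [b == t]eq_sym nt !andbF.
  by rewrite !(mulr0, mul0r) !addr0.
rewrite act2_comb4 !act_eps !eqxx {act_eps}.
by elim/ord2P: i; elim/ord2P: j; rewrite /= !(mul0r, mul1r, mulr0, addr0, add0r).
Qed.

Lemma act2_shift (r00 r01 r10 r11 : K) (X Y : 'M[K]_N) (sigma pi : 'I_N -> 'I_N)
    f i j a b :
  monomial_mx X (fun=> 1) sigma -> monomial_mx Y (fun=> 1) pi ->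
  act2 (r00 *: ((delta_mx 0 0 *t X) *t (delta_mx 0 0 *t Y))
   + r01 *: ((delta_mx 0 0 *t 1%:M) *t (delta_mx 1 1 *t Y))
   + r10 *: ((delta_mx 1 1 *t X) *t (delta_mx 0 0 *t 1%:M))
   + r11 *: ((delta_mx 1 1 *t 1%:M) *t (delta_mx 1 1 *t 1%:M)))
    f (i, a) (j, b) =
  (if i == 0 then if j == 0 then r00 else r01
   else if j == 0 then r10 else r11) *
  f (i, if j == 0 then sigma a else a) (j, if i == 0 then pi b else b).
Proof.
move=> mX mY; have m1 := monomial1.
rewrite act2_comb4.
rewrite (act2_monomial _ _ _ _ _ _ _ mX mY) (act2_monomial _ _ _ _ _ _ _ m1 mY).
rewrite (act2_monomial _ _ _ _ _ _ _ mX m1) (act2_monomial _ _ _ _ _ _ _ m1 m1) /=.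
by elim/ord2P: i; elim/ord2P: j; rewrite /= !(mul0r, mul1r, mulr0, addr0, add0r).
Qed.

End Action.

Section LegIntertwine.
Variables (K : fieldType) (N : nat).
Local Notation site := ('I_2 * 'I_N)%type.
Local Notation d := (2 * N)%N.
Variable Q : 'M[K]_d.
Implicit Types (s t u : site) (M : 'M[K]_(d * d)) (f : site -> site -> site -> K).

(** A matrix acting on two legs is linear over functions of the third leg; with
    act3_tens12, act3_tens13 and act3_tens23 this moves Q on the spectator leg
    past it. *)
Lemma act2_lincomb M (c : site -> K) (g : site -> site -> site -> K) s t :
  act2 M (fun a b => \sum_p c p * g p a b) s t = \sum_p c p * act2 M (g p) s t.
Proof.
under [RHS]eq_bigr do rewrite /act2 mulr_sumr.
rewrite exchange_big; apply: eq_bigr => s' _.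
under [RHS]eq_bigr do rewrite mulr_sumr.
rewrite exchange_big; apply: eq_bigr => t' _.
by rewrite mulr_sumr; apply: eq_bigr => p _; rewrite mulrCA.
Qed.

Lemma act3_tens f s t u : act3 (Q *t Q *t Q) f s t u =
  \sum_s' \sum_t' \sum_u'
    Q (idx s) (idx s') * Q (idx t) (idx t') * Q (idx u) (idx u') * f s' t' u'.
Proof. by do 3!apply: eq_bigr => ? _; rewrite !tensmxE. Qed.

Lemma act2_tens (f : site -> site -> K) s t : act2 (Q *t Q) f s t =
  \sum_s' \sum_t' Q (idx s) (idx s') * Q (idx t) (idx t') * f s' t'.
Proof. by do 2!apply: eq_bigr => ? _; rewrite !tensmxE. Qed.

Lemma act3_tens12 f s t u : act3 (Q *t Q *t Q) f s t u =
  \sum_u' Q (idx u) (idx u') * act2 (Q *t Q) (fun a b => f a b u') s t.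
Proof.
under [RHS]eq_bigr do rewrite act2_tens mulr_sumr.
rewrite act3_tens [RHS]exchange_big; apply: eq_bigr => s' _.
under [RHS]eq_bigr do rewrite mulr_sumr.
rewrite [RHS]exchange_big; apply: eq_bigr => t' _; apply: eq_bigr => u' _.
by ring.
Qed.

Lemma act3_tens13 f s t u : act3 (Q *t Q *t Q) f s t u =
  \sum_t' Q (idx t) (idx t') * act2 (Q *t Q) (fun a b => f a t' b) s u.
Proof.
under [RHS]eq_bigr do rewrite act2_tens mulr_sumr.
rewrite act3_tens [RHS]exchange_big; apply: eq_bigr => s' _.
under [RHS]eq_bigr do rewrite mulr_sumr.
apply: eq_bigr => t' _; apply: eq_bigr => u' _.
by ring.
Qed.

Lemma act3_tens23 f s t u : act3 (Q *t Q *t Q) f s t u =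
  \sum_s' Q (idx s) (idx s') * act2 (Q *t Q) (fun a b => f s' a b) t u.
Proof.
rewrite act3_tens; apply: eq_bigr => s' _; rewrite act2_tens mulr_sumr.
apply: eq_bigr => t' _; rewrite mulr_sumr; apply: eq_bigr => u' _.
by rewrite !mulrA.
Qed.

Variables M M' : 'M[K]_(d * d).
Hypothesis MQ : M *m (Q *t Q) = (Q *t Q) *m M'.

Let act2_MQ (f : site -> site -> K) : act2 M (act2 (Q *t Q) f) = act2 (Q *t Q) (act2 M' f).
Proof. by rewrite -!act2M MQ. Qed.

(** Q on the third leg commutes with leg12 M, so only the intertwining on the
    first two legs is used; likewise for the other two placements. *)
Lemma leg12_intertwine : leg12 M *m (Q *t Q *t Q) = (Q *t Q *t Q) *m leg12 M'.
Proof.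
apply: act3_inj => f s t u; rewrite !act3M act3_leg12 act3_tens12.
rewrite (_ : (fun s' t' => _) = fun a b => \sum_u' Q (idx u) (idx u') *
    act2 (Q *t Q) (fun a b => f a b u') a b).
  rewrite act2_lincomb; apply: eq_bigr => u' _; rewrite act2_MQ.
  by congr (_ * act2 _ _ _ _); apply/funext => a; apply/funext => b; rewrite act3_leg12.
by apply/funext => a; apply/funext => b; rewrite act3_tens12.
Qed.

Lemma leg13_intertwine : leg13 M *m (Q *t Q *t Q) = (Q *t Q *t Q) *m leg13 M'.
Proof.
apply: act3_inj => f s t u; rewrite !act3M act3_leg13 act3_tens13.
rewrite (_ : (fun s' t' => _) = fun a b => \sum_t' Q (idx t) (idx t') *
    act2 (Q *t Q) (fun a b => f a t' b) a b).
  rewrite act2_lincomb; apply: eq_bigr => t' _; rewrite act2_MQ.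
  by congr (_ * act2 _ _ _ _); apply/funext => a; apply/funext => b; rewrite act3_leg13.
by apply/funext => a; apply/funext => b; rewrite act3_tens13.
Qed.

Lemma leg23_intertwine : leg23 M *m (Q *t Q *t Q) = (Q *t Q *t Q) *m leg23 M'.
Proof.
apply: act3_inj => f s t u; rewrite !act3M act3_leg23 act3_tens23.
rewrite (_ : (fun s' t' => _) = fun a b => \sum_s' Q (idx s) (idx s') *
    act2 (Q *t Q) (fun a b => f s' a b) a b).
  rewrite act2_lincomb; apply: eq_bigr => s' _; rewrite act2_MQ.
  by congr (_ * act2 _ _ _ _); apply/funext => a; apply/funext => b; rewrite act3_leg23.
by apply/funext => a; apply/funext => b; rewrite act3_tens23.
Qed.

End LegIntertwine.

Section LegFunctions.
Variables (K : fieldType) (N : nat) (M : 'M[K]_(2 * N * (2 * N))).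
Lemma act3_leg12E f : act3 (leg12 M) f =
  fun s t u => act2 M (fun s' t' => f s' t' u) s t.
Proof. by do 3![apply/funext => ?]; exact: act3_leg12. Qed.
Lemma act3_leg13E f : act3 (leg13 M) f =
  fun s t u => act2 M (fun s' u' => f s' t u') s u.
Proof. by do 3![apply/funext => ?]; exact: act3_leg13. Qed.
Lemma act3_leg23E f : act3 (leg23 M) f =
  fun s t u => act2 M (fun t' u' => f s t' u') t u.
Proof. by do 3![apply/funext => ?]; exact: act3_leg23. Qed.
End LegFunctions.

Section Transfer.
Variables (K : fieldType) (N : nat).
Local Notation site := ('I_2 * 'I_N)%type.
Local Notation d := (2 * N)%N.

Lemma tensmx11 m n : (1%:M : 'M[K]_m) *t (1%:M : 'M[K]_n) = 1%:M.
Proof.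
apply/matrixP => i j; case: (mxtens_indexP i) => i1 i2; case: (mxtens_indexP j) => j1 j2.
rewrite tensmxE !mxE (inj_eq (can_inj (@mxtens_indexK m n))) xpair_eqE.
by case: eqP; case: eqP; rewrite /= ?(mulr0, mul0r, mulr1).
Qed.

(** Transfer principle: the Yang-Baxter equation may be checked after a change
    of basis Q on each leg, and there on the explicit operators F1, F2, F3. *)
Lemma ybe_of_intertwine (Q : 'M[K]_d) (M1 M2 M3 M1' M2' M3' : 'M[K]_(d * d))
    (F1 F2 F3 : (site -> site -> K) -> site -> site -> K) :
  Q \in unitmx ->
  M1 *m (Q *t Q) = (Q *t Q) *m M1' -> M2 *m (Q *t Q) = (Q *t Q) *m M2' ->
  M3 *m (Q *t Q) = (Q *t Q) *m M3' ->
  (forall f, act2 M1' f = F1 f) -> (forall f, act2 M2' f = F2 f) ->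
  (forall f, act2 M3' f = F3 f) ->
  (forall f s t u,
     F1 (fun s1 t1 => F2 (fun s2 u1 => F3 (fun t2 u2 => f s2 t2 u2) t1 u1) s1 u) s t =
     F3 (fun t1 u1 => F2 (fun s1 u2 => F1 (fun s2 t2 => f s2 t2 u2) s1 t1) s u1) t u) ->
  leg12 M1 *m leg13 M2 *m leg23 M3 = leg23 M3 *m leg13 M2 *m leg12 M1.
Proof.
move=> Qu h1 h2 h3 /funext e1 /funext e2 /funext e3 ybe.
set QQQ := Q *t Q *t Q.
have QQQu : QQQ \in unitmx.
  suff /mulmx1_unit[] : QQQ *m (invmx Q *t invmx Q *t invmx Q) = 1%:M by [].
  by rewrite !tensmx_mul !mulmxV // !tensmx11.
have push A A' B B' C C' : A *m QQQ = QQQ *m A' -> B *m QQQ = QQQ *m B' ->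
    C *m QQQ = QQQ *m C' -> A *m B *m C *m QQQ = QQQ *m (A' *m B' *m C').
  by move=> hA hB hC; rewrite -mulmxA hC mulmxA -(mulmxA A) hB mulmxA hA -!mulmxA.
apply: (can_inj (mulmxK QQQu)).
rewrite (push _ _ _ _ _ _ (leg12_intertwine h1) (leg13_intertwine h2) (leg23_intertwine h3)).
rewrite (push _ _ _ _ _ _ (leg23_intertwine h3) (leg13_intertwine h2) (leg12_intertwine h1)).
congr (QQQ *m _); apply: act3_inj => f s t u; rewrite !act3M.
by rewrite !act3_leg12E !act3_leg13E !act3_leg23E e1 e2 e3 ybe.
Qed.

End Transfer.

(** * Complex exponential and logarithmic series *)

Section ComplexAnalysis.
Import numFieldNormedType.Exports ComplexField.Normc.
Local Open Scope classical_set_scope.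
Variable R : realType.
Implicit Types x y z : R[i].

Local Notation Re := (@complex.Re R).
Local Notation Im := (@complex.Im R).

Lemma cReD x y : Re (x + y) = Re x + Re y. Proof. by case: x y => ? ? []. Qed.
Lemma cImD x y : Im (x + y) = Im x + Im y. Proof. by case: x y => ? ? []. Qed.
Lemma cReN x : Re (- x) = - Re x. Proof. by case: x. Qed.
Lemma cImN x : Im (- x) = - Im x. Proof. by case: x. Qed.
Lemma cReM x y : Re (x * y) = Re x * Re y - Im x * Im y.
Proof. by case: x y => ? ? []. Qed.
Lemma cImM x y : Im (x * y) = Re x * Im y + Im x * Re y.
Proof. by case: x y => ? ? []. Qed.
Lemma Re_sum I (r : seq I) (F : I -> R[i]) :
  Re (\sum_(i <- r) F i) = \sum_(i <- r) Re (F i).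
Proof. exact: (big_morph _ cReD). Qed.
Lemma Im_sum I (r : seq I) (F : I -> R[i]) :
  Im (\sum_(i <- r) F i) = \sum_(i <- r) Im (F i).
Proof. exact: (big_morph _ cImD). Qed.

Lemma normr_normc z : `|z| = ((normc z)%:C)%C. Proof. by []. Qed.

Lemma normr_lt1_normc z : (`|z| < 1) = (normc z < 1).
Proof. by rewrite normr_normc -[1 in LHS]/((1 : R)%:C)%C ltcR. Qed.

Lemma normcX z n : normc (z ^+ n) = normc z ^+ n.
Proof. by elim: n => [|n IH]; rewrite ?expr0 ?normc1 // !exprS normcM IH. Qed.

Lemma normc_ge0 z : 0 <= normc z.
Proof. by rewrite -lecR -normr_normc normr_ge0. Qed.

Lemma normRe_le z : `|Re z| <= normc z.
Proof. by rewrite -lecR; exact: normc_ge_Re. Qed.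

Lemma normIm_le z : `|Im z| <= normc z.
Proof.
have := normRe_le (z * Complex 0 1); rewrite cReM /= mulr0 mulr1 sub0r normrN.
move/le_trans; apply; rewrite normcM /= expr0n expr1n add0r sqrtr1 mulr1 //.
Qed.

Lemma normc_le z : normc z <= `|Re z| + `|Im z|.
Proof.
case: z => a b; have := le_normcD (Complex a 0) (Complex 0 b).
by rewrite /= !expr0n /= !addr0 !add0r !sqrtr_sqr.
Qed.

Lemma cexpD x y : cexp (x + y) = cexp x * cexp y.
Proof.
case: x y => [a b] [c d]; rewrite /cexp /= expRD cosD sinD.
by apply/eqP; rewrite eq_complex /=; apply/andP; split; apply/eqP; ring.
Qed.

Lemma cexp0 : cexp (0 : R[i]) = 1.
Proof. by rewrite /cexp /= expR0 cos0 sin0 mulr0 mulr1. Qed.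

Lemma cexp_neq0 x : cexp x != 0.
Proof.
apply/eqP => e; have := cexp0.
by rewrite -(subrr x) cexpD e mul0r => /esym/eqP; rewrite oner_eq0.
Qed.

Lemma cexpN x : cexp (- x) = (cexp x)^-1.
Proof.
by apply: (mulfI (cexp_neq0 x)); rewrite -cexpD subrr cexp0 divff // cexp_neq0.
Qed.

(** Reduces limits in the modulus topology to limits of real and imaginary
    parts, to which the criteria for real series apply. *)
Lemma complex_limn (u : nat -> R[i]) (a b : R) :
  (Re (u n) @[n --> \oo] --> a) -> (Im (u n) @[n --> \oo] --> b) ->
  limn (u : nat -> R[i]^o) = Complex a b.
Proof.
move=> ua ub; apply/cvg_lim => //.
apply/(@cvgrPdist_lt _ R[i]^o) => e.
rewrite ltcE /= => /andP[/eqP Im_e egt0].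
have e2 : 0 < Re e / 2 by rewrite divr_gt0.
move/cvgrPdist_lt/(_ _ e2) : ua => ua; move/cvgrPdist_lt/(_ _ e2) : ub => ub.
near=> n.
have [ha hb] : `|a - Re (u n)| < Re e / 2 /\ `|b - Im (u n)| < Re e / 2.
  by split; near: n.
rewrite normr_normc ltcE /= Im_e eqxx /=.
apply: (le_lt_trans (normc_le _)).
by rewrite cReD cReN cImD cImN /= [ltRHS]splitr ltrD.
Unshelve. all: by end_near.
Qed.

(** The real part of exp(U + i V) (p - i s) at the real time t. The imaginary
    part is exp_wave U V (- s) p, so that one estimate serves both. *)
Definition exp_wave (U V p s : {poly R}) (t : R) : R :=
  expR U.[t] * (cos V.[t] * p.[t] + sin V.[t] * s.[t]).

Lemma is_derive_exp_wave U V p s (t : R) :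
  is_derive t 1 (exp_wave U V p s)
   (expR U.[t] * (cos V.[t] * (U^`() * p + V^`() * s + p^`()).[t] +
                  sin V.[t] * (U^`() * s - V^`() * p + s^`()).[t])).
Proof.
have -> : exp_wave U V p s = (expR \o horner U) *
    ((cos \o horner V) * horner p + (sin \o horner V) * horner s).
  by apply/funext.
apply: is_derive_eq.
rewrite /= /GRing.scale /= !hornerE /=.
rewrite [X in _ + X * _ * _](_ : _ = cos V.[t] * p.[t] + sin V.[t] * s.[t]) //.
ring.
Qed.

(** Mean value estimate: exp(U + i V) (p - i s) hardly varies on [0, 1] when
    (U' + i V') (p - i s) + (p - i s)' is small there. *)
Lemma exp_wave_increment U V p s (M eps : R) :
  (forall t, 0 < t < 1 -> [/\ U.[t] <= M,
     `|(U^`() * p + V^`() * s + p^`()).[t]| <= eps &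
     `|(U^`() * s - V^`() * p + s^`()).[t]| <= eps]) ->
  `|exp_wave U V p s 1 - exp_wave U V p s 0| <= expR M * (eps + eps).
Proof.
move=> bnd.
have [|c c01 ->] := @MVT R (exp_wave U V p s) _ 0 1 ltr01
  (fun t _ => is_derive_exp_wave U V p s t).
  apply: derivable_within_continuous => t _.
  by case: (is_derive_exp_wave U V p s t).
have [UM Ae Be] := bnd c c01.
rewrite subr0 mulr1 normrM gtr0_norm ?expR_gt0 // ler_pM ?expR_ge0 ?ler_expR //.
apply: (le_trans (ler_normD _ _)); rewrite lerD // normrM.
  by rewrite -[eps]mul1r ler_pM // ler_norml cos_geN1 cos_le1.
by rewrite -[eps]mul1r ler_pM // ler_norml sin_geN1 sin_le1.
Qed.

Lemma normc_nat n : normc (n%:R : R[i]) = n%:R.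
Proof. by rewrite normcMn normc1. Qed.

(** The series start at k = 1; a vanishing term at k = 0 is added so that they
    become ordinary series. *)
Lemma sum_from1 (V : zmodType) (F : nat -> V) n : F 0%N = 0 ->
  \sum_(1 <= k < n) F k = \sum_(0 <= k < n) F k.
Proof.
move=> F0; case: n => [|n]; first by rewrite !big_geq.
by rewrite [RHS]big_ltn // F0 add0r.
Qed.

Lemma cvg_dominated_series (t : nat -> R) (B rho : R) :
  0 <= rho < 1 -> (forall k, `|t k| <= B * rho ^+ k) -> cvgn (series t).
Proof.
move=> /andP[rho0 rho1] tB; apply: normed_cvg.
apply: (@series_le_cvg _ _ (geometric B rho)) => [n|n|n|] //=.
- by apply: le_trans (tB n).
- by apply: is_cvg_geometric_series; rewrite ger0_norm.
Qed.

Definition dominated (t : nat -> R[i]) := t 0%N = 0 /\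
  exists B rho, 0 <= rho < 1 /\ forall k, normc (t k) <= B * rho ^+ k.

(** The sum of a complex series through its real and imaginary parts; it agrees
    with the limit of the partial sums for dominated series [limn_csum]. *)
Definition csum (t : nat -> R[i]) : R[i] :=
  Complex (limn (series (Re \o t))) (limn (series (Im \o t))).

Lemma cvg_Re_csum t : dominated t ->
  Re (\sum_(1 <= k < n) t k) @[n --> \oo] --> Re (csum t).
Proof.
move=> [t0 [B [rho [rho01 tB]]]].
rewrite (_ : (fun n => _) = series (Re \o t)).
  apply: (@cvg_dominated_series _ B rho) => // k.
  exact: le_trans (normRe_le _) (tB k).
by apply/funext => n; rewrite Re_sum sum_from1 ?t0.
Qed.

Lemma cvg_Im_csum t : dominated t ->
  Im (\sum_(1 <= k < n) t k) @[n --> \oo] --> Im (csum t).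
Proof.
move=> [t0 [B [rho [rho01 tB]]]].
rewrite (_ : (fun n => _) = series (Im \o t)).
  apply: (@cvg_dominated_series _ B rho) => // k.
  exact: le_trans (normIm_le _) (tB k).
by apply/funext => n; rewrite Im_sum sum_from1 ?t0.
Qed.

Lemma limn_csum t : dominated t ->
  limn (fun n => \sum_(1 <= k < n) t k : R[i]^o) = csum t.
Proof.
move=> tdom.
by rewrite (complex_limn (cvg_Re_csum tdom) (cvg_Im_csum tdom)); case: csum.
Qed.

Lemma csumD t u : dominated t -> dominated u ->
  csum (fun k => t k + u k) = csum t + csum u.
Proof.
move=> [_ [B [rho [rho01 tB]]]] [_ [B' [rho' [rho01' uB]]]].
have cRe (v : nat -> R[i]) b r : 0 <= r < 1 ->
    (forall k, normc (v k) <= b * r ^+ k) -> cvgn (series (Re \o v)).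
  move=> r01 vb; apply: (@cvg_dominated_series _ b r) => // k.
  exact: le_trans (normRe_le _) (vb k).
have cIm (v : nat -> R[i]) b r : 0 <= r < 1 ->
    (forall k, normc (v k) <= b * r ^+ k) -> cvgn (series (Im \o v)).
  move=> r01 vb; apply: (@cvg_dominated_series _ b r) => // k.
  exact: le_trans (normIm_le _) (vb k).
rewrite /csum; apply/eqP; rewrite eq_complex /=; apply/andP; split; apply/eqP.
- rewrite -[RHS](lim_seriesD (cRe _ _ _ rho01 tB) (cRe _ _ _ rho01' uB)).
  by congr (limn (series _)); apply/funext => k /=; rewrite cReD.
- rewrite -[RHS](lim_seriesD (cIm _ _ _ rho01 tB) (cIm _ _ _ rho01' uB)).
  by congr (limn (series _)); apply/funext => k /=; rewrite cImD.
Qed.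

(** Equal to 0 at k = 0, since the inverse of 0 is 0. *)
Definition logterm x k : R[i] := x ^+ k / k%:R.

Lemma dominated_scaled_log (c : nat -> R[i]) (B : R) x :
  normc x < 1 -> 0 <= B -> (forall k, (0 < k)%N -> normc (c k) <= B) ->
  dominated (fun k => c k * logterm x k).
Proof.
move=> x1 B0 cB; split; first by rewrite /logterm invr0 !mulr0.
exists B, (normc x); split=> [|[|k]]; first by rewrite normc_ge0.
  by rewrite /logterm invr0 !mulr0 normc0 mulr_ge0.
rewrite normcM ler_pM ?normc_ge0 ?cB // normcM normcX normcV normc_nat.
by rewrite ler_piMr ?exprn_ge0 ?normc_ge0 // invf_le1 ?ltr0n // ler1n.
Qed.

Lemma dominated_log x : normc x < 1 -> dominated (logterm x).
Proof.
move=> x1; rewrite (_ : logterm x = fun k => 1 * logterm x k).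
  by apply: (@dominated_scaled_log _ 1) => // k _; rewrite normc1.
by apply/funext => k; rewrite mul1r.
Qed.

Lemma ReMr x (a : R) : Re (x * (a%:C)%C) = Re x * a.
Proof. by rewrite cReM /= mulr0 subr0. Qed.
Lemma ImMr x (a : R) : Im (x * (a%:C)%C) = Im x * a.
Proof. by rewrite cImM /= mulr0 add0r. Qed.

Section Log.
Variables (x : R[i]) (x_lt1 : normc x < 1).

(** Real or imaginary part (f is Re or Im) of the truncated series
    sum_(k < n) (t x)^k / k, as a polynomial in the real time t. *)
Definition logpoly (f : R[i] -> R) n : {poly R} :=
  \sum_(1 <= k < n) f (logterm x k) *: 'X^k.

Lemma deriv_logpoly f n t : (forall y a, f (y * (a%:C)%C) = f y * a) ->
  (logpoly f n)^`().[t] = \sum_(1 <= k < n) f (x ^+ k) * t ^+ k.-1.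
Proof.
move=> fM; rewrite /logpoly (raddf_sum (@deriv R)) horner_sum.
apply: eq_big_nat => k /andP[k_gt0 _]; rewrite /= derivZ derivXn hornerZ hornerMn hornerXn.
rewrite /logterm (_ : k%:R^-1 = ((k%:R^-1 : R)%:C)%C).
  by rewrite fM -mulr_natr; field; rewrite pnatr_eq0 -lt0n.
by rewrite fmorphV rmorph_nat.
Qed.

Lemma geometric_telescope n (t : R) : (0 < n)%N ->
  (\sum_(1 <= k < n) x ^+ k * ((t ^+ k.-1)%:C)%C) * (1 - x * (t%:C)%C) =
  x - x ^+ n * ((t ^+ n.-1)%:C)%C.
Proof.
elim: n => // -[|n] IH _; first by rewrite big_geq // mul0r expr1 expr0 mulr1 subrr.
rewrite big_nat_recr //= mulrDl IH //= !exprS !rmorphM !rmorphXn /=; ring.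
Qed.

Lemma logpoly_bound n (t : R) : 0 <= t <= 1 ->
  (logpoly Re n).[t] <= (1 - normc x)^-1.
Proof.
move=> /andP[t0 t1].
have [_ tB] := dominated_log x_lt1.
have termB k : (0 < k)%N -> Re (logterm x k) * t ^+ k <= normc x ^+ k.
  move=> k0; apply: le_trans (ler_norm _) _.
  rewrite normrM -[leRHS]mulr1 ler_pM //; last first.
    by rewrite ger0_norm ?exprn_ge0 // exprn_ile1.
  apply: (le_trans (normRe_le _)); rewrite normcM normcX normcV normc_nat.
  by rewrite ler_piMr ?exprn_ge0 ?normc_ge0 // invf_le1 ?ltr0n // ler1n.
rewrite /logpoly horner_sum.
apply: (@le_trans _ _ (\sum_(0 <= k < n) normc x ^+ k)).
  case: n => [|n]; first by rewrite !big_geq.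
  rewrite [leRHS]big_ltn // expr0 ler_wpDl //.
  apply: ler_sum_nat => k /andP[k0 _].
  by rewrite hornerZ hornerXn termB.
rewrite -div1r ler_pdivlMr ?subr_gt0 // mulrC -opprB mulNr big_mkord -subrX1.
by rewrite opprB gerBl exprn_ge0 ?normc_ge0.
Qed.

(** The truncated logarithm L(t) of 1 / (1 - t x) satisfies
    L'(t) (1 - t x) - x = - x^n t^(n-1): a geometric sum. The conclusions are its
    real part and the opposite of its imaginary part. *)
Lemma logpoly_ode n (t : R) : (0 < n)%N ->
  let U := logpoly Re n in let V := logpoly Im n in
  let p : {poly R} := 1 - Re x *: 'X in let s : {poly R} := Im x *: 'X in
  (U^`() * p + V^`() * s + p^`()).[t] = - (Re (x ^+ n) * t ^+ n.-1) /\
  (U^`() * s - V^`() * p + s^`()).[t] = Im (x ^+ n) * t ^+ n.-1.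
Proof.
move=> n0 U V p s.
pose S := \sum_(1 <= k < n) x ^+ k * ((t ^+ k.-1)%:C)%C.
have US : U^`().[t] = Re S.
  by rewrite deriv_logpoly; [rewrite Re_sum; under [RHS]eq_bigr do rewrite ReMr|exact: ReMr].
have VS : V^`().[t] = Im S.
  by rewrite deriv_logpoly; [rewrite Im_sum; under [RHS]eq_bigr do rewrite ImMr|exact: ImMr].
have pE : p.[t] = 1 - Re x * t by rewrite /p !hornerE.
have sE : s.[t] = Im x * t by rewrite /s !hornerE.
have dp : p^`().[t] = - Re x by rewrite /p derivB derivC derivZ derivX !hornerE.
have ds : s^`().[t] = Im x by rewrite /s derivZ derivX !hornerE.
clearbody U V p s; rewrite !(hornerD, hornerM, hornerN) US VS pE sE dp ds.
have := geometric_telescope t n0; rewrite -/S => e.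
have := congr1 Re e; have := congr1 Im e.
rewrite !(cReM, cImM, cReD, cImD, cReN, cImN) /= => e1 e2.
by split; lra.
Qed.

(** Along the segment t x, the product exp(L(t)) (1 - t x), with L the truncated
    logarithmic series, starts at 1 and has derivative of size O(|x|^n); hence it
    ends at 1 up to O(|x|^n), and n tends to infinity. *)
Lemma cexp_log : cexp (csum (logterm x)) * (1 - x) = 1.
Proof.
pose rho := normc x.
pose p : {poly R} := 1 - Re x *: 'X; pose s : {poly R} := Im x *: 'X.
pose M := expR (1 - rho)^-1.
have rho0 : 0 <= rho by exact: normc_ge0.
have xnB n (t : R) : 0 < t < 1 ->
    `|Re (x ^+ n) * t ^+ n.-1| <= rho ^+ n /\ `|Im (x ^+ n) * t ^+ n.-1| <= rho ^+ n.
  move=> /andP[t0 t1].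
  have tn : `|t ^+ n.-1| <= 1 by rewrite ger0_norm ?exprn_ge0 ?exprn_ile1 // ltW.
  by rewrite -[rho ^+ n]mulr1 -normcX !normrM !ler_pM ?normRe_le ?normIm_le.
have incr n : (0 < n)%N ->
   `|exp_wave (logpoly Re n) (logpoly Im n) p s 1 - 1| <= M * (rho ^+ n + rho ^+ n) /\
   `|exp_wave (logpoly Re n) (logpoly Im n) (- s) p 1| <= M * (rho ^+ n + rho ^+ n).
  move=> n0.
  have logpoly0 f : (logpoly f n).[0] = 0.
    rewrite horner_sum big_nat big1 // => k /andP[k0 _].
    by rewrite hornerZ hornerXn expr0n -leqn0 leqNgt k0 mulr0.
  have w1 : exp_wave (logpoly Re n) (logpoly Im n) p s 0 = 1.
    by rewrite /exp_wave !logpoly0 expR0 cos0 sin0 /p /s !hornerE; ring.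
  have w2 : exp_wave (logpoly Re n) (logpoly Im n) (- s) p 0 = 0.
    by rewrite /exp_wave !logpoly0 expR0 cos0 sin0 /p /s !hornerE; ring.
  have I1 := @exp_wave_increment (logpoly Re n) (logpoly Im n) p s (1 - rho)^-1 (rho ^+ n).
  have I2 := @exp_wave_increment (logpoly Re n) (logpoly Im n) (- s) p (1 - rho)^-1 (rho ^+ n).
  rewrite w1 in I1; rewrite w2 subr0 in I2.
  split; [apply: I1|apply: I2] => t t01; have [Re_le Im_le] := xnB n t t01.
    have [-> ->] := logpoly_ode t n0; rewrite normrN; split=> //.
    by apply: logpoly_bound; rewrite !ltW //; case/andP: t01.
  have [A B] := logpoly_ode t n0; split=> //.
  - by apply: logpoly_bound; rewrite !ltW //; case/andP: t01.
  - set U := logpoly Re n in A B *; set V := logpoly Im n in A B *.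
    rewrite (_ : _ + _ = - (U^`() * s - V^`() * p + s^`())).
      by rewrite hornerN B normrN.
    by rewrite derivN; ring.
  - set U := logpoly Re n in A B *; set V := logpoly Im n in A B *.
    rewrite (_ : _ + _ = U^`() * p + V^`() * s + p^`()) ?A ?normrN //.
    by ring.
have cvg0 : M * (rho ^+ n + rho ^+ n) @[n --> \oo] --> (0 : R).
  rewrite (_ : (fun n => _) = geometric (M * 2) rho).
    by apply: cvg_geometric; rewrite ger0_norm.
  by apply/funext => n /=; ring.
have cU : (logpoly Re n).[1] @[n --> \oo] --> Re (csum (logterm x)).
  rewrite (_ : (fun n => _) = fun n => Re (\sum_(1 <= k < n) logterm x k)).
    exact/cvg_Re_csum/dominated_log.
  apply/funext => n; rewrite horner_sum Re_sum; apply: eq_bigr => k _.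
  by rewrite hornerZ hornerXn expr1n mulr1.
have cV : (logpoly Im n).[1] @[n --> \oo] --> Im (csum (logterm x)).
  rewrite (_ : (fun n => _) = fun n => Im (\sum_(1 <= k < n) logterm x k)).
    exact/cvg_Im_csum/dominated_log.
  apply/funext => n; rewrite horner_sum Im_sum; apply: eq_bigr => k _.
  by rewrite hornerZ hornerXn expr1n mulr1.
have cwave p' s' : exp_wave (logpoly Re n) (logpoly Im n) p' s' 1 @[n --> \oo] -->
    expR (Re (csum (logterm x))) *
    (cos (Im (csum (logterm x))) * p'.[1] + sin (Im (csum (logterm x))) * s'.[1]).
  apply: cvgM; first by apply: continuous_cvg; [exact: continuous_expR|exact: cU].
  apply: cvgD; apply: cvgM; try exact: cvg_cst.
    apply: continuous_cvg; [exact: continuous_cos|exact: cV].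
  apply: continuous_cvg; [exact: continuous_sin|exact: cV].
have limE (a : nat -> R) l b : a n @[n --> \oo] --> l ->
    (forall n, (0 < n)%N -> `|a n - b| <= M * (rho ^+ n + rho ^+ n)) -> l = b.
  move=> al ab; apply/eqP; rewrite -subr_eq0 -normr_le0.
  apply: (ler_cvg_to _ cvg0); last by exists 1%N => //= n; exact: ab.
  by apply: cvg_norm; apply: cvgB => //; exact: cvg_cst.
have := limE _ _ _ (cwave p s) (fun n n0 => (incr n n0).1).
have incr2 n : (0 < n)%N ->
    `|exp_wave (logpoly Re n) (logpoly Im n) (- s) p 1 - 0| <= M * (rho ^+ n + rho ^+ n).
  by move=> n0; rewrite subr0; exact: (incr n n0).2.
have := limE _ _ _ (cwave (- s) p) incr2.
rewrite hornerN /p /s !hornerE => e2 e1.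
apply/eqP; rewrite eq_complex cReM cImM cReD cImD cReN cImN /=; apply/andP; split; apply/eqP.
  by rewrite -[RHS]e1; ring.
by rewrite -[RHS]e2; ring.
Qed.

End Log.

End ComplexAnalysis.

(** * The functional equation of the function A *)

Section AfunTheory.
Import numFieldNormedType.Exports ComplexField.Normc.
Local Open Scope classical_set_scope.
Variable R : realType.
Implicit Types x y z : R[i].

Lemma normc_neq0 x : (normc x != 0) = (x != 0).
Proof.
by congr negb; apply/eqP/eqP => [/eq0_normc|->]; rewrite ?normc0.
Qed.

Lemma one_sub_neq0 x : normc x < 1 -> 1 - x != 0.
Proof.
move=> x1; rewrite subr_eq0; apply: contraTneq x1 => <-.
by rewrite normc1 ltxx.
Qed.

(** Applied to b = q^(2k), since
    (q^k - q^-k) / (q^k + q^-k) = - (1 - b) / (1 + b). *)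
Lemma moebius_bound b (delta : R) : normc b <= delta -> delta < 1 ->
  1 + b != 0 /\ normc ((1 - b) / (1 + b)) <= 2 / (1 - delta).
Proof.
move=> bd d1.
have b1 : normc b < 1 by exact: le_lt_trans bd d1.
have den : 1 - delta <= normc (1 + b).
  rewrite lerBlDr; have := le_normcD (1 + b) (- b).
  by rewrite addrK normc1 normcN => /le_trans; apply; rewrite lerD2l.
have d0 : 0 < 1 - delta by rewrite subr_gt0.
split; first by rewrite -normc_neq0 gt_eqF // (lt_le_trans d0).
rewrite normcM normcV ler_pM ?normc_ge0 ?invr_ge0 ?normc_ge0 //.
  apply: (le_trans (le_normcD _ _)); rewrite normc1 normcN.
  by rewrite -[2]/(1 + 1) lerD2l ltW.
by rewrite lef_pV2 // posrE (lt_le_trans d0).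
Qed.

(** What the series of A requires of q: nonzero denominators and bounded
    coefficients. *)
Definition cosh_regular (q : R[i]) := exists2 B : R, 0 <= B &
  forall k, (0 < k)%N -> q ^+ k + q ^- k != 0 /\
    normc ((q ^+ k - q ^- k) / (q ^+ k + q ^- k)) <= B.

Lemma cosh_regular_norm_lt1 q : q != 0 -> normc q < 1 -> cosh_regular q.
Proof.
move=> q0 q1; exists (2 / (1 - normc q)).
  by rewrite divr_ge0 // subr_ge0 ltW.
move=> k k0; have qk0 : q ^+ k != 0 by rewrite expf_neq0.
have [|den bnd] := @moebius_bound (q ^+ (k + k)) (normc q) _ q1.
  rewrite normcX -{2}[normc q]expr1 ler_wiXn2l ?normc_ge0 ?(ltW q1) //.
  by rewrite (leq_trans k0) ?leq_addr.
have dE : q ^+ k + q ^- k = (1 + q ^+ (k + k)) / q ^+ k.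
  by rewrite exprD; field.
have nE : q ^+ k - q ^- k = - (1 - q ^+ (k + k)) / q ^+ k.
  by rewrite exprD; field.
split; first by rewrite dE mulf_neq0 ?invr_eq0.
rewrite dE nE (_ : _ / _ = - ((1 - q ^+ (k + k)) / (1 + q ^+ (k + k)))).
  by rewrite normcN.
by rewrite exprD in den *; field; rewrite qk0 den.
Qed.

Lemma cosh_regularV q : cosh_regular q^-1 -> cosh_regular q.
Proof.
move=> [B B0 H]; exists B => // k /H; rewrite -exprVn invrK exprVn => -[den bnd].
split; first by rewrite addrC.
by rewrite -opprB mulNr normcN [q ^+ k + _]addrC.
Qed.

(** If q^k + q^-k = 0, then q^(4k) = 1, so the odd order of q divides k and
    q^k = 1, contradicting q^(2k) = -1. The coefficients are periodic in k, hence
    bounded by their sum over one period. *)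
Lemma cosh_regular_odd_root m q :
  (2 * m + 1)%N.-primitive_root q -> cosh_regular q.
Proof.
set n := (2 * m + 1)%N => qn.
pose c k := normc ((q ^+ k - q ^- k) / (q ^+ k + q ^- k)).
exists (\sum_(i < n) c i); first by apply: sumr_ge0 => i _; exact: normc_ge0.
have q0 : q != 0.
  by apply/eqP => qz; have /eqP := prim_expr_order qn; rewrite qz /n addn1 expr0n eq_sym oner_eq0.
move=> k _; split.
  have qk0 : q ^+ k != 0 by rewrite expf_neq0.
  apply/eqP => /(congr1 ( *%R^~ (q ^+ k))).
  rewrite mul0r mulrDl mulVf // => /eqP; rewrite addr_eq0 => /eqP qkk.
  have : q ^+ (4 * k) = 1.
    rewrite (_ : (4 * k = k + k + (k + k))%N); last by ring.
    by rewrite !exprD qkk mulrNN mulr1.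
  move/eqP; rewrite -(prim_order_dvd qn) Gauss_dvdr; last first.
    by apply: (@coprimeXr 2 n 2); rewrite coprimen2 /n addn1 oddS mul2n odd_double.
  rewrite (prim_order_dvd qn) => /eqP qk1; move: qkk; rewrite qk1 mulr1 => /eqP.
  by rewrite -addr_eq0 -mulr2n pnatr_eq0.
have -> : normc ((q ^+ k - q ^- k) / (q ^+ k + q ^- k)) = c (k %% n)%N.
  by rewrite /c !(prim_expr_mod qn).
have kn : (k %% n < n)%N by rewrite ltn_mod /n addn1.
rewrite (bigD1 (Ordinal kn)) //= lerDl sumr_ge0 // => i _; exact: normc_ge0.
Qed.

Lemma cosh_regularP q : q != 0 ->
  (`|q| <> 1 \/ exists m : nat, (1 <= m)%N /\ (2 * m + 1)%N.-primitive_root q) ->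
  cosh_regular q.
Proof.
move=> q0 [|[m [_ /cosh_regular_odd_root//]]].
rewrite normr_normc => q1; have [qlt|qgt|qeq] := ltgtP (normc q) 1.
- exact: cosh_regular_norm_lt1.
- apply: cosh_regularV; apply: cosh_regular_norm_lt1; first by rewrite invr_eq0.
  by rewrite normcV invf_lt1 // (lt_trans ltr01).
- by case: q1; rewrite qeq.
Qed.

Section FunctionalEquation.
Variables (q : R[i]) (q_neq0 : q != 0) (q_reg : cosh_regular q).

Let c k := (q ^+ k - q ^- k) / (q ^+ k + q ^- k).

Lemma AfunE x : normc x < 1 -> Afun q x = cexp (- csum (fun k => c k * logterm x k)).
Proof.
move=> x1; have termE : (fun n => \sum_(1 <= k < n)
      (x ^+ k * (q ^+ k - q ^- k) / (k%:R * (q ^+ k + q ^- k)) : R[i]^o)) =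
    (fun n => \sum_(1 <= k < n) c k * logterm x k : R[i]^o).
  by apply/funext => n; apply: eq_bigr => k _; rewrite /c /logterm invfM; ring.
have [B B0 H] := q_reg; rewrite /Afun termE limn_csum //.
by apply: (dominated_scaled_log x1 B0) => k /H[].
Qed.

Lemma Afun_neq0 x : normc x < 1 -> Afun q x != 0.
Proof. by move=> x1; rewrite AfunE // cexp_neq0. Qed.

(** With c_k = (q^k - q^-k) / (q^k + q^-k), one has
    (1 + c_k) x^k = (1 - c_k) (q^2 x)^k; so the series of A(x) and A(q^2 x) add up
    to the logarithmic series at q^2 x minus the one at x. *)
Lemma AfunM x : normc x < 1 -> normc (x * q ^+ 2) < 1 ->
  Afun q x * Afun q (x * q ^+ 2) = (1 - x * q ^+ 2) / (1 - x).
Proof.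
move=> x1 xq1; have [B B0 H] := q_reg.
have cB k : (0 < k)%N -> normc (c k) <= B by move=> /H[].
have domc y : normc y < 1 -> dominated (fun k => c k * logterm y k).
  by move=> y1; exact: (dominated_scaled_log y1 B0).
have dom1 : dominated (fun k => (1 - c k) * logterm (x * q ^+ 2) k).
  apply: (dominated_scaled_log xq1 (addr_ge0 ler01 B0)) => k k0.
  by apply: (le_trans (le_normcD _ _)); rewrite normc1 normcN lerD2l cB.
(* Regrouped so that each sum is one of dominated series. *)
have e1 : csum (logterm x) + csum (fun k => c k * logterm x k) =
    csum (fun k => (1 - c k) * logterm (x * q ^+ 2) k).
  rewrite -csumD; [|exact: dominated_log|exact: domc].
  congr csum; apply/funext => -[|k]; first by rewrite /logterm invr0 !mulr0 addr0.
  have [den _] := H k.+1 isT; have qk0 : q ^+ k.+1 != 0 by rewrite expf_neq0.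
  have q2k : 1 + q ^+ k.+1 * q ^+ k.+1 != 0.
    apply: contraNneq den => e; apply/eqP; apply: (mulIf qk0).
    by rewrite mulrDl mulVf // addrC e mul0r.
  rewrite /logterm /c exprMn -exprM mulnC exprM expr2.
  by field; rewrite qk0 [_ + 1]addrC q2k -(natrD _ 1) pnatr_eq0.
have e2 : csum (fun k => (1 - c k) * logterm (x * q ^+ 2) k) +
    csum (fun k => c k * logterm (x * q ^+ 2) k) = csum (logterm (x * q ^+ 2)).
  rewrite -csumD; [|exact: dom1|exact: domc].
  by congr csum; apply/funext => k; ring.
have logE y : normc y < 1 -> cexp (- csum (logterm y)) = 1 - y.
  move=> y1; rewrite cexpN; apply: (mulfI (cexp_neq0 (csum (logterm y)))).
  by rewrite cexp_log // divff // cexp_neq0.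
rewrite !AfunE // -(logE _ x1) -(logE _ xq1) -cexpN -!cexpD opprK.
by apply: (congr1 (@cexp R)); rewrite -e2 -e1; ring.
Qed.

End FunctionalEquation.
End AfunTheory.

(** * The discrete Fourier transform *)

Section Fourier.
Variables (R : realType) (n : nat).
Local Notation N := n.+1.
Variable omega : R[i].
Hypothesis omega_prim : N.-primitive_root omega.

(** Indices in Z/N with N = n + 1: this form of N makes the index type an
    additive group, on which chi is a character. *)
Definition chi (a : 'I_N) : R[i] := omega ^+ a.
Definition tau : 'I_N := inZp 1.

Lemma omega_neq0 : omega != 0.
Proof.
apply/eqP => o0; have /eqP := prim_expr_order omega_prim.
by rewrite o0 expr0n eq_sym oner_eq0.
Qed.

Lemma chiD a b : chi (a + b) = chi a * chi b.
Proof. by rewrite /chi -exprD /= (prim_expr_mod omega_prim). Qed.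

Lemma chi_tau : chi tau = omega.
Proof. by rewrite /chi /tau /= (prim_expr_mod omega_prim) expr1. Qed.

Lemma chi_neq0 a : chi a != 0.
Proof. by rewrite expf_neq0 ?omega_neq0. Qed.

Lemma chiN a : chi (- a) = (chi a)^-1.
Proof.
apply: (mulfI (chi_neq0 a)); rewrite -chiD subrr divff ?chi_neq0 //.
Qed.

Lemma chiX a : chi a ^+ N = 1.
Proof. by rewrite /chi -exprM mulnC exprM (prim_expr_order omega_prim) expr1n. Qed.

Lemma chi_inj : injective chi.
Proof.
move=> a b /eqP; rewrite /chi (eq_prim_root_expr omega_prim).
by rewrite !modn_small // => /eqP/val_inj.
Qed.

Lemma ordSE (a : 'I_N) : ordS a = a + tau.
Proof. by apply: val_inj; rewrite /= modnDmr addn1. Qed.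

Local Notation C := (Cmx R N).
Local Notation D := (Dmx N omega).
Local Notation P := (Pmx N omega).

Lemma CmxE a b : C a b = (b == a + tau)%:R.
Proof.
rewrite /Cmx summxE (sum_only (x := a)) => [|c nc].
  by rewrite mxE eqxx ordSE.
by rewrite mxE eq_sym (negbTE nc).
Qed.

Lemma DmxE a b : D a b = if b == a then chi a else 0.
Proof.
rewrite /Dmx summxE (sum_only (x := a)) => [|c nc].
  by rewrite !mxE eqxx; case: eqP; rewrite ?mulr1 ?mulr0.
by rewrite !mxE eq_sym (negbTE nc) mulr0.
Qed.

Lemma PmxE a b : P a b = chi b ^+ a.
Proof.
rewrite /chi -exprM mulnC; have -> : P = \matrix_(s, t) omega ^+ (s * t)%N.
  rewrite [RHS]matrix_sum_delta; apply: eq_bigr => s _; apply: eq_bigr => t _.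
  by rewrite mxE.
by rewrite mxE.
Qed.

Lemma PmxE' a b : P a b = chi a ^+ b.
Proof. by rewrite PmxE /chi -!exprM mulnC. Qed.

Lemma monomialC : monomial_mx C (fun => 1) (+%R^~ tau).
Proof. by move=> a b; rewrite CmxE; case: eqP. Qed.

Lemma monomialCT : monomial_mx C^T (fun => 1) (fun a => a - tau).
Proof.
move=> a b; rewrite mxE CmxE -(inj_eq (addIr tau) b) subrK eq_sym.
by case: eqP.
Qed.

Lemma monomialD : monomial_mx D chi id.
Proof. by move=> a b; rewrite DmxE. Qed.

Lemma monomialDX k : monomial_mx (D ^+ k) (fun a => chi a ^+ k) id.
Proof.
elim: k => [|k IH].
  by move=> a b; rewrite expr0 (monomial1 _ a b).
have := monomialM monomialD IH; rewrite -[D *m _]/(D * D ^+ k) -exprS => H a b.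
by rewrite H exprS.
Qed.

Definition diag_of (h : 'I_N -> R[i]) : 'M[R[i]]_N := \matrix_(a, b) if b == a then h a else 0.

Lemma monomial_diag_of h : monomial_mx (diag_of h) h id.
Proof. by move=> a b; rewrite mxE. Qed.

Lemma invmx_uniq (A B : 'M[R[i]]_N) : A *m B = 1%:M -> invmx A = B.
Proof.
move=> AB1; have [uA _] := mulmx1_unit AB1.
by rewrite -[invmx A]mulmx1 -AB1 mulKmx.
Qed.

Lemma invmxDX k : D ^+ k *m diag_of (fun a => chi a ^- k) = 1%:M.
Proof.
apply/matrixP => a b.
rewrite (monomialM (monomialDX k) (monomial_diag_of _) a b) (monomial1 _ a b) /=.
by rewrite divff // expf_neq0 ?chi_neq0.
Qed.

Lemma monomial_invDX k : monomial_mx (invmx (D ^+ k)) (fun a => chi a ^- k) id.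
Proof. by rewrite (invmx_uniq (invmxDX k)); exact: monomial_diag_of. Qed.

Lemma mulCmxtr : C *m C^T = 1%:M.
Proof.
apply/matrixP => a b.
by rewrite (monomialM monomialC monomialCT a b) (monomial1 _ a b) /= mulr1 addrK.
Qed.

(** P is the Vandermonde matrix of the N distinct powers of omega. *)
Lemma Pmx_unit : P \in unitmx.
Proof.
have -> : P = Vandermonde N (\row_a chi a).
  by apply/matrixP => a b; rewrite PmxE !mxE.
rewrite unitmxE det_Vandermonde unitfE; apply/prodf_neq0 => i _.
apply/prodf_neq0 => j ij; rewrite !mxE subr_eq0.
by apply: contraTneq ij => /chi_inj ->; rewrite ltnn.
Qed.

Lemma mulCmxPmx : C *m P = P *m D.
Proof.
apply/matrixP => a b; rewrite !mxE (sum_only (x := a + tau)) => [|c nc]; last first.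
  by rewrite (monomialC a) (negbTE nc) mul0r.
rewrite (sum_only (x := b)) => [|c nc]; last first.
  by rewrite DmxE eq_sym (negbTE nc) mulr0.
by rewrite CmxE DmxE !eqxx mul1r !PmxE' chiD exprMn chi_tau.
Qed.

(** The transpose of C is its inverse, so conjugation by P sends D to C^-1. *)
Lemma mulDmxPmx : D *m P = P *m C^T.
Proof.
apply/matrixP => a b; rewrite !mxE (sum_only (x := a)) => [|c nc]; last first.
  by rewrite DmxE (negbTE nc) mul0r.
rewrite (sum_only (x := b + tau)) => [|c nc]; last first.
  by rewrite mxE CmxE (negbTE nc) mulr0.
by rewrite mxE CmxE DmxE !eqxx mulr1 !PmxE chiD exprMn chi_tau mulrC.
Qed.

Lemma Cmx_unit : C \in unitmx. Proof. by have [] := mulmx1_unit mulCmxtr. Qed.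
Lemma Dmx_unit : D \in unitmx.
Proof. by have := invmxDX 1; rewrite expr1 => /mulmx1_unit[]. Qed.

Lemma intertwineM (A A' B B' : 'M[R[i]]_N) :
  A *m P = P *m A' -> B *m P = P *m B' -> A *m B *m P = P *m (A' *m B').
Proof. by move=> hA hB; rewrite -mulmxA hB mulmxA hA mulmxA. Qed.

Lemma intertwineV (A A' : 'M[R[i]]_N) : A \in unitmx -> A' \in unitmx ->
  A *m P = P *m A' -> invmx A *m P = P *m invmx A'.
Proof.
move=> uA uA' h; apply: (can_inj (mulKmx uA)); rewrite mulKVmx // mulmxA h.
by rewrite -mulmxA mulmxV // mulmx1.
Qed.

Lemma intertwineX (A A' : 'M[R[i]]_N) k :
  A *m P = P *m A' -> A ^+ k *m P = P *m A' ^+ k.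
Proof.
move=> h; elim: k => [|k IH]; first by rewrite !expr0 mul1mx mulmx1.
by rewrite !exprS; exact: intertwineM.
Qed.

Lemma mulinvCmxXPmx k : invmx (C ^+ k) *m P = P *m invmx (D ^+ k).
Proof.
apply: intertwineV; last exact: intertwineX mulCmxPmx.
  exact: (unitrX k Cmx_unit).
exact: (unitrX k Dmx_unit).
Qed.

Lemma mulinvDmxPmx : invmx D *m P = P *m C.
Proof.
have CE : C = invmx C^T by rewrite (invmx_uniq (mulmx1C mulCmxtr)).
by rewrite CE; apply: intertwineV mulDmxPmx; rewrite ?unitmx_tr ?Dmx_unit ?Cmx_unit.
Qed.

End Fourier.

(** * The factors of R in the Fourier basis *)

Section TensorSums.
Variable K : fieldType.

Lemma tensmx_suml m n p q I (r : seq I) (c : I -> K) (A : I -> 'M[K]_(m, n))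
    (B : 'M[K]_(p, q)) :
  (\sum_(i <- r) c i *: A i) *t B = \sum_(i <- r) c i *: (A i *t B).
Proof.
apply/matrixP => i j; case: (mxtens_indexP i) => i1 i2; case: (mxtens_indexP j) => j1 j2.
rewrite tensmxE !summxE mulr_suml; apply: eq_bigr => k _.
by rewrite [in RHS]mxE tensmxE mxE mulrA.
Qed.

Lemma tensmx_sumr m n p q I (r : seq I) (c : I -> K) (A : I -> 'M[K]_(m, n))
    (B : 'M[K]_(p, q)) :
  B *t (\sum_(i <- r) c i *: A i) = \sum_(i <- r) c i *: (B *t A i).
Proof.
apply/matrixP => i j; case: (mxtens_indexP i) => i1 i2; case: (mxtens_indexP j) => j1 j2.
rewrite tensmxE !summxE mulr_sumr; apply: eq_bigr => k _.
by rewrite [in RHS]mxE tensmxE mxE mulrCA.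
Qed.

End TensorSums.

Section FourierFactors.
Variables (R : realType) (n : nat).
Local Notation N := n.+1.
Variables (omega q r z : R[i]).
Hypothesis omega_prim : N.-primitive_root omega.

Local Notation C := (Cmx R N).
Local Notation D := (Dmx N omega).
Local Notation P := (Pmx N omega).
Local Notation PP := (Pacute N omega *t Pacute N omega).
Local Notation chi := (@chi R n omega).
Local Notation tau := (@tau n).

(** The factors of R(z) after conjugation by P: C has become D, and D has
    become C^-1, written as the transpose of C. *)
Definition R_1_fourier : 'M[R[i]]_(2 * N * (2 * N)) :=
  1%:M - ((q ^+ 2 - 1) * q^-1 / (1 - z ^+ N)) *:
    \sum_(k < N) (z * omega) ^+ k *:
      ((e_ R 0 1 *t (C^T *m D ^+ k)) *t (e_ R 1 0 *t invmx (D ^+ k))).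

Definition R_0_fourier : 'M[R[i]]_(2 * N * (2 * N)) :=
  1%:M - (z * (q ^+ 2 - 1) * q^-1 / (1 - z ^+ N)) *:
    \sum_(k < N) z ^+ k *:
      ((e_ R 1 0 *t (C *m D ^+ k.+1)) *t (e_ R 0 1 *t invmx (D ^+ k.+1))).

Definition R_delta_fourier : 'M[R[i]]_(2 * N * (2 * N)) :=
  \sum_(s < N) \sum_(t < N)
    (Afun q (z * omega ^ (s%:Z - t%:Z + 1)) *:
       ((e_ R 0 0 *t eps_ R s s) *t (e_ R 0 0 *t eps_ R t t))
     + (Afun q (z * q ^- 2 * omega ^ (s%:Z - t%:Z)))^-1 *:
       ((e_ R 0 0 *t eps_ R s s) *t (e_ R 1 1 *t eps_ R t t))
     + (Afun q (z * q ^+ 2 * omega ^ (s%:Z - t%:Z + 1)))^-1 *: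
       ((e_ R 1 1 *t eps_ R s s) *t (e_ R 0 0 *t eps_ R t t))
     + Afun q (z * omega ^ (s%:Z - t%:Z)) *:
       ((e_ R 1 1 *t eps_ R s s) *t (e_ R 1 1 *t eps_ R t t))).

Definition R_h_fourier : 'M[R[i]]_(2 * N * (2 * N)) :=
  r^-1 *: ((e_ R 0 0 *t C) *t (e_ R 0 0 *t C^T))
  + r *: ((e_ R 0 0 *t 1%:M) *t (e_ R 1 1 *t C^T))
  + r *: ((e_ R 1 1 *t C) *t (e_ R 0 0 *t 1%:M))
  + r^-1 *: ((e_ R 1 1 *t 1%:M) *t (e_ R 1 1 *t 1%:M)).

Lemma intertwine_tens (e e' : 'M[R[i]]_2) A A' B B' :
  A *m P = P *m A' -> B *m P = P *m B' ->
  ((e *t A) *t (e' *t B)) *m PP = PP *m ((e *t A') *t (e' *t B')).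
Proof.
by move=> hA hB; rewrite !tensmx_mul !mulmx1 !mul1mx hA hB.
Qed.

Lemma intertwine_add M M' L L' : M *m PP = PP *m M' -> L *m PP = PP *m L' ->
  (M + L) *m PP = PP *m (M' + L').
Proof. by move=> hM hL; rewrite mulmxDl mulmxDr hM hL. Qed.

Lemma intertwine_mul M M' L L' : M *m PP = PP *m M' -> L *m PP = PP *m L' ->
  M *m L *m PP = PP *m (M' *m L').
Proof. by move=> hM hL; rewrite -mulmxA hL mulmxA hM mulmxA. Qed.

Lemma intertwine_scale c M M' : M *m PP = PP *m M' -> (c *: M) *m PP = PP *m (c *: M').
Proof. by move=> hM; rewrite -scalemxAl -scalemxAr hM. Qed.

Lemma intertwine_sum (F F' : 'I_N -> 'M[R[i]]_(2 * N * (2 * N))) :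
  (forall k, F k *m PP = PP *m F' k) ->
  (\sum_k F k) *m PP = PP *m \sum_k F' k.
Proof.
by move=> h; rewrite mulmx_suml mulmx_sumr; apply: eq_bigr => k _; exact: h.
Qed.

Lemma intertwine_R_1 : R_1 N omega q z *m PP = PP *m R_1_fourier.
Proof.
apply: intertwine_add; first by rewrite mul1mx mulmx1.
rewrite mulNmx mulmxN; congr (- _).
apply/intertwine_scale/intertwine_sum => k; apply: intertwine_scale.
apply: intertwine_tens; last exact: mulinvCmxXPmx.
exact: intertwineM (mulDmxPmx omega_prim) (intertwineX _ (mulCmxPmx omega_prim)).
Qed.

Lemma intertwine_R_0 : R_0 N omega q z *m PP = PP *m R_0_fourier.
Proof.
apply: intertwine_add; first by rewrite mul1mx mulmx1.
rewrite mulNmx mulmxN; congr (- _).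
apply/intertwine_scale/intertwine_sum => k; apply: intertwine_scale.
apply: intertwine_tens; last exact: mulinvCmxXPmx.
exact: intertwineM (mulinvDmxPmx omega_prim) (intertwineX _ (mulCmxPmx omega_prim)).
Qed.

Lemma Pacute_unit : Pacute N omega \in unitmx.
Proof.
suff /mulmx1_unit[] : Pacute N omega *m (1%:M *t invmx P) = 1%:M by [].
by rewrite tensmx_mul mulmx1 mulmxV ?tensmx11 // (Pmx_unit omega_prim).
Qed.

Lemma mulVPP : (invmx (Pacute N omega) *t invmx (Pacute N omega)) *m PP = 1%:M.
Proof. by rewrite tensmx_mul mulVmx ?tensmx11 // Pacute_unit. Qed.

(** R_delta is defined by conjugation with P on both legs. *)
Lemma intertwine_R_delta : R_delta N omega q z *m PP = PP *m R_delta_fourier.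
Proof. by rewrite -mulmxA mulVPP mulmx1. Qed.

Lemma diag_of_sum h : diag_of h = \sum_(s < N) h s *: eps_ R s s.
Proof.
apply/matrixP => a b; rewrite mxE summxE (sum_only (x := a)) => [|c nc].
  by rewrite !mxE eqxx; case: eqP; rewrite ?mulr1 ?mulr0.
by rewrite !mxE eq_sym (negbTE nc) mulr0.
Qed.

Lemma tens_diag_of c (e e' : 'M[R[i]]_2) (g h : 'I_N -> R[i]) :
  c *: ((e *t diag_of g) *t (e' *t diag_of h)) =
  \sum_(s < N) \sum_(t < N)
    (c * (g s * h t)) *: ((e *t eps_ R s s) *t (e' *t eps_ R t t)).
Proof.
rewrite !diag_of_sum (tensmx_sumr _ g) tensmx_suml scaler_sumr.
apply: eq_bigr => s _; rewrite !tensmx_sumr !scaler_sumr.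
by apply: eq_bigr => t _; rewrite !scalerA.
Qed.

Lemma diag_of1 : diag_of (fun=> 1) = 1%:M :> 'M[R[i]]_N.
Proof. by apply/matrixP => a b; rewrite !mxE eq_sym; case: eqP. Qed.

Lemma diag_of_chi : diag_of chi = D.
Proof. by apply/matrixP => a b; rewrite mxE DmxE. Qed.

Lemma diag_of_chiV : diag_of (fun a => (chi a)^-1) = invmx D.
Proof.
have := invmx_uniq (invmxDX omega_prim 1); rewrite expr1 => ->.
by congr diag_of.
Qed.

Lemma chi_int (a b : 'I_N) : omega ^ (a%:Z - b%:Z) = chi (a - b).
Proof.
rewrite (chiD omega_prim) (chiN omega_prim) expfzDr ?(omega_neq0 omega_prim) //.
by rewrite -exprnN.
Qed.

Lemma chi_intS (a b : 'I_N) : omega ^ (a%:Z - b%:Z + 1) = chi (a - b + tau).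
Proof.
by rewrite expfzDr ?(omega_neq0 omega_prim) // chi_int [RHS](chiD omega_prim) (chi_tau omega_prim).
Qed.

(** The exponents of omega factor over the two legs, so that the Cartan factor
    is a combination of four pure tensors in powers of D. *)
Lemma R_hE : R_h N omega r =
  r^-1 *: ((e_ R 0 0 *t invmx D) *t (e_ R 0 0 *t D))
  + r *: ((e_ R 0 0 *t 1%:M) *t (e_ R 1 1 *t D))
  + r *: ((e_ R 1 1 *t invmx D) *t (e_ R 0 0 *t 1%:M))
  + r^-1 *: ((e_ R 1 1 *t 1%:M) *t (e_ R 1 1 *t 1%:M)).
Proof.
rewrite -diag_of1 -diag_of_chiV -diag_of_chi !tens_diag_of -!big_split.
apply: eq_bigr => s _; rewrite -!big_split; apply: eq_bigr => t _ /=.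
rewrite chi_int (chiD omega_prim) (chiN omega_prim) [chi t * _]mulrC.
rewrite -exprnN -/(chi t) -/(chi s).
by rewrite !mulr1 !mul1r.
Qed.

Lemma intertwine_R_h : R_h N omega r *m PP = PP *m R_h_fourier.
Proof.
have one : 1%:M *m P = P *m 1%:M by rewrite mul1mx mulmx1.
have inD := mulinvDmxPmx omega_prim; have mD := mulDmxPmx omega_prim.
rewrite R_hE; do 3?apply: intertwine_add; apply: intertwine_scale; exact: intertwine_tens.
Qed.

End FourierFactors.

(** The factor 1 - z^N in the denominators of R_1 and R_0 cancels against the
    geometric sum, because y is z times an N-th root of unity. *)
Lemma geometric_weight (K : fieldType) m (c z y : K) :
  y ^+ m = z ^+ m -> 1 - y != 0 -> 1 - z ^+ m != 0 ->
  c / (1 - z ^+ m) * (\sum_(k < m) y ^+ k) = c / (1 - y).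
Proof.
move=> <- y1 ym; have e : (1 - y) * (\sum_(k < m) y ^+ k) = 1 - y ^+ m.
  by rewrite -[1 - y]opprB mulNr -subrX1 opprB.
by apply: (mulfI y1); rewrite mulrCA e divfK // mulrCA divff // mulr1.
Qed.

Lemma power_weight (K : fieldType) k (z w u v y : K) : w * u / v = y ->
  (z * w) ^+ k * (1 * u ^+ k) * v ^- k = (z * y) ^+ k.
Proof. by move=> <-; rewrite mul1r -exprVn -!exprMn !mulrA. Qed.

Lemma power_weightS (K : fieldType) k (z u v y : K) : u / v = y ->
  z ^+ k * (1 * u ^+ k.+1) * v ^- k.+1 = y * (z * y) ^+ k.
Proof.
move=> <-; rewrite mul1r -[v ^- _]exprVn -mulrA -exprMn exprS mulrCA.
by rewrite -exprMn.
Qed.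

Lemma lower_coefficient (K : fieldType) (q z x y : K) : q != 0 ->
  x * (z * (q ^+ 2 - 1) * q^-1 / y) = (q - q^-1) * (z * x) / y.
Proof.
move=> q0; rewrite (_ : z * (q ^+ 2 - 1) * q^-1 = z * (q - q^-1)); first by ring.
by field.
Qed.

Section Weights.
Import ComplexField.Normc.
Variables (R : realType) (n : nat).
Local Notation N := n.+1.
Local Notation site := ('I_2 * 'I_N)%type.
Variables (omega q r z : R[i]).
Hypotheses (omega_prim : N.-primitive_root omega) (q_neq0 : q != 0)
  (z_lt1 : normc z < 1).

Local Notation chi := (@chi R n omega).
Local Notation tau := (@tau n).
Implicit Types (f : site -> site -> R[i]).

Lemma normc_chi a : normc (chi a) = 1.
Proof.
have /eqP := congr1 (@normc R) (chiX omega_prim a).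
by rewrite normcX normc1 pexpr_eq1 ?normc_ge0 // => /eqP.
Qed.

Let zchi_neq0 a : 1 - z * chi a != 0.
Proof. by rewrite one_sub_neq0 // normcM normc_chi mulr1. Qed.

Let zN_neq0 : 1 - z ^+ N != 0.
Proof. by rewrite one_sub_neq0 // normcX exprn_ilt1 ?normc_ge0. Qed.

Let zchiX a : (z * chi a) ^+ N = z ^+ N.
Proof. by rewrite exprMn chiX // mulr1. Qed.

Lemma act_R_h_fourier f : act2 (R_h_fourier n r) f = shift_op tau r f.
Proof.
apply/funext => -[i a]; apply/funext => -[j b].
rewrite (act2_shift _ _ _ _ _ _ _ _ _ (@monomialC R n) (@monomialCT R n)).
by rewrite /shift_op /=; elim/ord2P: i; elim/ord2P: j;
  rewrite /shift /= ?addr0 ?subr0.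
Qed.

Lemma act_R_delta_fourier f :
  act2 (R_delta_fourier n omega q z) f =
  diagonal_op (delta_weight chi tau q (Afun q) z) f.
Proof.
apply/funext => -[i a]; apply/funext => -[j b].
pose A00 (s t : 'I_N) := Afun q (z * omega ^ (s%:Z - t%:Z + 1)).
pose A01 (s t : 'I_N) := (Afun q (z * q ^- 2 * omega ^ (s%:Z - t%:Z)))^-1.
pose A10 (s t : 'I_N) := (Afun q (z * q ^+ 2 * omega ^ (s%:Z - t%:Z + 1)))^-1.
pose A11 (s t : 'I_N) := Afun q (z * omega ^ (s%:Z - t%:Z)).
rewrite (act2_diagonal A00 A01 A10 A11) /diagonal_op /delta_weight /=.
apply: (congr1 (fun x => x * f (i, a) (j, b))).
have chi_ab := chi_int omega_prim a b; have e1 := chi_intS omega_prim a b.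
case: (i == 0); case: (j == 0).
- exact: (congr1 (fun x => Afun q (z * x)) e1).
- exact: (congr1 (fun x => (Afun q (z * q ^- 2 * x))^-1) chi_ab).
- exact: (congr1 (fun x => (Afun q (z * q ^+ 2 * x))^-1) e1).
- exact: (congr1 (fun x => Afun q (z * x)) chi_ab).
Qed.

Lemma act_R_1_fourier f : act2 (R_1_fourier n omega q z) f =
  raise_op tau (fun a => (q - q^-1) / (1 - z * chi a)) f.
Proof.
have mTD k := monomialM (@monomialCT R n) (@monomialDX R n omega k).
apply/funext => -[i a]; apply/funext => -[j b].
rewrite (act2_exchange _ _ _ _ _ _ _ _ _ _ _ _ mTD (monomial_invDX omega_prim)).
apply: (congr1 (fun x => f (i, a) (j, b) - ((i == 0) && (j == 1))%:R * (x * _))).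
have e : omega * chi (a - tau) / chi b = chi (a - b).
  rewrite (chiD omega_prim a (- tau)) (chiD omega_prim a) !(chiN omega_prim).
  by rewrite (chi_tau omega_prim) mulrCA mulfV ?mulr1 // (omega_neq0 omega_prim).
rewrite (eq_bigr _ (fun (k : 'I_N) _ => power_weight k z e)) geometric_weight //.
by rewrite mulrBl mul1r expr2 mulfK.
Qed.

Lemma act_R_0_fourier f : act2 (R_0_fourier n omega q z) f =
  lower_op tau (fun a => (q - q^-1) * (z * chi (a + tau)) / (1 - z * chi (a + tau))) f.
Proof.
have mCD k := monomialM (@monomialC R n) (@monomialDX R n omega k.+1).
apply/funext => -[i a]; apply/funext => -[j b].
rewrite (act2_exchange _ _ _ _ _ _ _ _ _ _ _ _ mCD
  (fun k => monomial_invDX omega_prim k.+1)).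
apply: (congr1 (fun x => f (i, a) (j, b) - ((i == 1) && (j == 0))%:R * (x * _))).
have e : chi (a + tau) / chi b = chi (a - b + tau).
  by rewrite -(chiN omega_prim) -(chiD omega_prim) addrAC.
rewrite (eq_bigr _ (fun (k : 'I_N) _ => power_weightS k z e)) -mulr_sumr.
rewrite mulrCA geometric_weight //.
exact: lower_coefficient.
Qed.

End Weights.

(** * Assembly *)

Lemma inverse_ratios (K : fieldType) (A : K -> K) (q x : K) : q != 0 ->
  1 - x != 0 -> 1 - x * q ^+ 2 != 0 -> 1 - x * q ^- 2 != 0 ->
  A (x * q ^+ 2) != 0 -> A (x * q ^- 2) != 0 ->
  A x * A (x * q ^+ 2) = (1 - x * q ^+ 2) / (1 - x) ->
  A (x * q ^- 2) * A (x * q ^- 2 * q ^+ 2) =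
    (1 - x * q ^- 2 * q ^+ 2) / (1 - x * q ^- 2) ->
  [/\ 1 - x != 0, 1 - q ^+ 2 * x != 0,
     (A (x * q ^+ 2))^-1 = A x * (1 - x) / (1 - q ^+ 2 * x) &
     (A (x * q ^- 2))^-1 = A x * (1 - x * q ^- 2) / (1 - x)].
Proof.
move=> q0 d1 d2 d3 aq aV; rewrite divfK ?expf_neq0 // [q ^+ 2 * x]mulrC.
move=> /(canRL (mulfK aq)) e /(canRL (mulKf aV)) eV; split=> //.
  by rewrite e; field; rewrite aq d1 d2.
by rewrite eV; move: (x / q ^+ 2) aV d3 => y aV d3; field; rewrite aV d1 d3.
Qed.

Section YangBaxter.
Import ComplexField.Normc.
Variables (R : realType) (n : nat) (omega q r : R[i]).
Local Notation N := n.+1.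
Hypotheses (omega_prim : N.-primitive_root omega) (q_neq0 : q != 0)
  (q_reg : cosh_regular q) (rq : r ^+ 2 = q).

Definition Rmx_fourier z := R_1_fourier n omega q z *m R_delta_fourier n omega q z
  *m R_0_fourier n omega q z *m R_h_fourier n r.

Lemma intertwine_Rmx z : Rmx N omega q r z *m (Pacute N omega *t Pacute N omega) =
  (Pacute N omega *t Pacute N omega) *m Rmx_fourier z.
Proof.
apply: intertwine_mul (intertwine_R_h _ omega_prim).
apply: intertwine_mul (intertwine_R_0 _ _ omega_prim).
exact: intertwine_mul (intertwine_R_1 _ _ omega_prim) (intertwine_R_delta _ _ omega_prim).
Qed.

(** The functional equation at x and at q^-2 x. *)
Lemma Afun_ratios x : normc x < 1 -> normc (x * q ^+ 2) < 1 -> normc (x * q ^- 2) < 1 ->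
  [/\ 1 - x != 0, 1 - q ^+ 2 * x != 0,
     (Afun q (x * q ^+ 2))^-1 = Afun q x * (1 - x) / (1 - q ^+ 2 * x) &
     (Afun q (x * q ^- 2))^-1 = Afun q x * (1 - x * q ^- 2) / (1 - x)].
Proof.
move=> x1 xq xqV.
have xqVq : x * q ^- 2 * q ^+ 2 = x by rewrite divfK ?expf_neq0.
apply: inverse_ratios q_neq0 (one_sub_neq0 x1) (one_sub_neq0 xq) (one_sub_neq0 xqV)
  (Afun_neq0 q_reg xq) (Afun_neq0 q_reg xqV) (AfunM q_neq0 q_reg x1 xq) _.
by apply: (AfunM q_neq0 q_reg xqV); rewrite xqVq.
Qed.

Lemma act_Rmx_fourier z f : normc z < 1 -> normc (z * q ^+ 2) < 1 -> normc (z * q ^- 2) < 1 ->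
  act2 (Rmx_fourier z) f =
  twisted_op (@chi R n omega) (@tau n) q (six_vertex_norm q r (Afun q)) z f.
Proof.
move=> z1 zq zqV.
have e := act2_factors f (act_R_1_fourier omega_prim q_neq0 z1) (act_R_delta_fourier q z omega_prim)
  (act_R_0_fourier omega_prim q_neq0 z1) (@act_R_h_fourier R n r).
apply: (etrans e).
apply/funext => s; apply/funext => t; apply: factored_op => // a x.
have xn y : normc (z * y) < 1 -> normc (x * y) < 1.
  by move=> zy; rewrite /x mulrAC normcM (normc_chi omega_prim) mulr1.
apply: Afun_ratios; [|exact: xn|exact: xn].
by rewrite -[x]mulr1; apply: xn; rewrite mulr1.
Qed.

End YangBaxter.

Unset Implicit Arguments.

Theorem theorem6p1 (R : realType) (N : nat) (omega q r z w : R[i])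
    (hN : (0 < N)%N)
    (homega : N.-primitive_root omega)
    (hq0 : q != 0)
    (hq : `|q| <> 1 \/
          exists m : nat, (1 <= m)%N /\ (2 * m + 1)%N.-primitive_root q)
    (hr : r ^+ 2 = q)
    (hz0 : z != 0) (hw0 : w != 0)
    (hlt1 : forall u : R[i],
      u \in [:: z; w; z * w;
                z * q ^+ 2; w * q ^+ 2; z * w * q ^+ 2;
                z * q ^- 2; w * q ^- 2; z * w * q ^- 2] ->
      `|u| < 1) :
  leg12 (Rmx N omega q r z) *m leg13 (Rmx N omega q r (z * w))
    *m leg23 (Rmx N omega q r w) =
  leg23 (Rmx N omega q r w) *m leg13 (Rmx N omega q r (z * w))
    *m leg12 (Rmx N omega q r z).
Proof.
(* The successor form of N gives the positions their group structure. *)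
case: N hN homega => [hN|n _ homega]; first case: (notF hN).
have q_reg := cosh_regularP hq0 hq.
(* Positions 0, 1, 2 of the list are z, w, z w; adding 3 or 6 multiplies by q^2 or q^-2. *)
have lt1 k : (k < 9)%N -> ComplexField.Normc.normc (nth 0
    [:: z; w; z * w; z * q ^+ 2; w * q ^+ 2; z * w * q ^+ 2;
        z * q ^- 2; w * q ^- 2; z * w * q ^- 2] k) < 1.
  by move=> k9; rewrite -normr_lt1_normc; apply: hlt1; apply: mem_nth.
have op x f := @act_Rmx_fourier R n omega q r homega hq0 q_reg hr x f.
have opz f := op z f (lt1 0%N isT) (lt1 3%N isT) (lt1 6%N isT).
have opw f := op w f (lt1 1%N isT) (lt1 4%N isT) (lt1 7%N isT).
have opzw f := op (z * w) f (lt1 2%N isT) (lt1 5%N isT) (lt1 8%N isT).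
exact: (ybe_of_intertwine (Pacute_unit homega) (intertwine_Rmx q r homega z)
  (intertwine_Rmx q r homega (z * w)) (intertwine_Rmx q r homega w) opz opzw opw
  (twisted_op_ybe (@tau n) (chiD homega) q _ z w)).
Qed.
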